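(* Let $(X,x)\subset(\mathbb{C}^n,x)$, $(Y,y)\subset(\mathbb{C}^m,y)$ and $(Z,z)\subset(\mathbb{C}^l,z)$ be germs of complex analytic spaces, with morphisms $\alpha:(Z,z)\to(X,x)$ and $\beta:(Z,z)\to(Y,y)$ whose induced homomorphisms $\alpha_z^*:\mathcal{O}_{X,x}\to\mathcal{O}_{Z,z}$ and $\beta_z^*:\mathcal{O}_{Y,y}\to\mathcal{O}_{Z,z}$ are surjective and not isomorphisms. Let $(\mathcal{V},v)=(X,x)\sqcup_{(Z,z)}(Y,y)$, and suppose that one of the following conditions holds: (i) $(\mathcal{V},v)$ is weakly large and there is a surjective map $\mathcal{O}_{Y,y}\twoheadrightarrow\mathcal{O}_{X,x}$; (ii) $(\mathcal{V},v)$ is strongly large. If $(W,w)$ is a subspace of $(Y,y)$, then the Poincaré series of $(W,w)$ as a subspace of $(\mathcal{V},v)$ is $$P^{(\mathcal{V},v)}_{(W,w)}(t)=\frac{P^{(Y,y)}_{(W,w)}(t)\,P^{(X,x)}_{(Z,z)}(t)}{P^{(X,x)}_{(Z,z)}(t)+P^{(Y,y)}_{(Z,z)}(t)-P^{(X,x)}_{(Z,z)}(t)P^{(Y,y)}_{(Z,z)}(t)}.$$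
   Context: Germs: for a germ $(X,x)\subset(\mathbb{C}^n,x)$ of a complex analytic space, $\mathcal{O}_{X,x}\cong\mathcal{O}_{\mathbb{C}^n,x}/\mathcal{I}_{X,x}$ where $\mathcal{I}_{X,x}$ is the ideal of all germs of holomorphic functions vanishing on $X$; it is a reduced Noetherian local analytic $\mathbb{C}$-algebra with residue field $\mathbb{C}$. A subspace $(W,w)$ of $(X,x)$ is one defined by a reduced (i.e. radical) ideal $I\subset\mathcal{O}_{X,x}$, with local ring $\mathcal{O}_{X,x}/I$. Poincaré series: for a finitely generated $\mathcal{O}_{X,x}$-module $M$, $P^{\mathcal{O}_{X,x}}_M(t)=\sum_{i\ge0}\beta_i^{\mathcal{O}_{X,x}}(M)t^i$, where $\beta_i^{\mathcal{O}_{X,x}}(M)=\dim_{\mathbb{C}}\mathrm{Tor}_i^{\mathcal{O}_{X,x}}(M,\mathbb{C})$. For a subspace $(W,w)$ defined by $I$, $P^{(X,x)}_{(W,w)}(t):=P^{\mathcal{O}_{X,x}}_{\mathcal{O}_{X,x}/I}(t)$. Gluing: $(\mathcal{V},v)=(X,x)\sqcup_{(Z,z)}(Y,y)$ is the pushout of $\alpha:(Z,z)\to(X,x)$ and $\beta:(Z,z)\to(Y,y)$, with canonical morphisms $f:(X,x)\to(\mathcal{V},v)$ and $g:(Y,y)\to(\mathcal{V},v)$. Its local ring is the fiber product $\mathcal{O}_{\mathcal{V},v}=\{(s,t)\in\mathcal{O}_{X,x}\times\mathcal{O}_{Y,y}:\alpha_z^*(s)=\beta_z^*(t)\}$, a Noetherian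 local analytic $\mathbb{C}$-algebra, and $f,g$ correspond to the surjective projections $\pi_1:\mathcal{O}_{\mathcal{V},v}\to\mathcal{O}_{X,x}$ and $\pi_2:\mathcal{O}_{\mathcal{V},v}\to\mathcal{O}_{Y,y}$. Through $\pi_1$ (resp. $\pi_2$), $\mathcal{O}_{X,x}$-modules (resp. $\mathcal{O}_{Y,y}$-modules) are $\mathcal{O}_{\mathcal{V},v}$-modules, and subspaces of $(X,x)$ (resp. $(Y,y)$) are regarded as subspaces of $(\mathcal{V},v)$. $(Z,z)$ is regarded as a subspace of $(X,x)$ and of $(Y,y)$ via $\alpha_z^*$ and $\beta_z^*$. Large morphism: a morphism $h:(Y',y')\to(X',x')$ of germs with $\mathcal{O}_{X',x'}\to\mathcal{O}_{Y',y'}$ surjective is large if for every subspace $(W,w)$ of $(Y',y')$, regarded as a subspace of $(X',x')$, one has $P^{(X',x')}_{(W,w)}=P^{(Y',y')}_{(W,w)}P^{(X',x')}_{(Y',y')}$. Weakly large gluing: $P^{\mathcal{O}_{\mathcal{V},v}}_{K}(t)=P^{\mathcal{O}_{X,x}}_{K}(t)\,P^{(\mathcal{V},v)}_{(X,x)}(t)$, where $K=\ker(\alpha_z^* )$ is viewed as an $\mathcal{O}_{X,x}$-module. Large gluing: the morphism $f$ is large. Strongly large gluing: both $f$ and $g$ are large.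
   Formalization: In condition (i) the surjective map φ from O_Y onto O_X is a ring homomorphism required to be compatible with the gluing, α*∘φ = β*; for an arbitrary surjection the stated formula is false. *)

(* Defs.v *)
From HB Require Import structures.
From mathcomp Require Import all_boot all_order all_algebra ring_quotient.
From mathcomp Require Import complex.
From mathcomp Require Import all_classical reals topology normedtype sequences.

Set Implicit Arguments.
Unset Strict Implicit.
Unset Printing Implicit Defensive.

Import Order.TTheory GRing.Theory Num.Theory.
Import numFieldNormedType.Exports.

Local Open Scope ring_scope.
Local Open Scope classical_set_scope.
Local Open Scope quotient_scope.

(* Formal power series over K, as coefficient sequences with the Cauchy product.
   Inverses are total: f^-1 is the inverse of f when f is a unit, f otherwise. *)
Definition fps (K : comNzRingType) : Type := nat -> K.

HB.instance Definition _ (K : comNzRingType) := GRing.Zmodule.on (fps K).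

Section FpsRing.
Variable K : comNzRingType.
Implicit Types f g h : fps K.

Definition fps_one : fps K := fun n => (n == 0%N)%:R.
Definition fps_mul f g : fps K := fun n => \sum_(i < n.+1) f i * g (n - i)%N.

Definition fps_trunc n f : {poly K} := \poly_(i < n.+1) f i.

Lemma fps_mulE n f g (p q : {poly K}) :
  (forall i, (i <= n)%N -> p`_i = f i) -> (forall i, (i <= n)%N -> q`_i = g i) ->
  forall i, (i <= n)%N -> (p * q)`_i = fps_mul f g i.
Proof.
move=> pf qg i lin; rewrite coefM; apply: eq_bigr => j _.
have lji : (j <= i)%N by rewrite -ltnS.
by rewrite pf ?qg // ?(leq_trans (leq_subr _ _)) // (leq_trans lji).
Qed.

Lemma fps_truncE n f i : (i <= n)%N -> (fps_trunc n f)`_i = f i.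
Proof. by move=> lin; rewrite coef_poly ltnS lin. Qed.

Lemma fps_mulC : commutative fps_mul.
Proof.
move=> f g; apply/funext => n.
rewrite -(fps_mulE (@fps_truncE n f) (@fps_truncE n g)) //.
by rewrite mulrC (fps_mulE (@fps_truncE n g) (@fps_truncE n f)).
Qed.

Lemma fps_mulA : associative fps_mul.
Proof.
move=> f g h; apply/funext => n.
have e1 := fps_mulE (@fps_truncE n g) (@fps_truncE n h).
have e2 := fps_mulE (@fps_truncE n f) (@fps_truncE n g).
rewrite -(fps_mulE (@fps_truncE n f) e1) // mulrA.
by rewrite (fps_mulE e2 (@fps_truncE n h)).
Qed.

Lemma fps_mul1 : left_id fps_one fps_mul.
Proof.
move=> f; apply/funext => n; rewrite /fps_mul big_ord_recl subn0 mul1r.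
by rewrite big1 ?addr0 // => i _; rewrite mul0r.
Qed.

Lemma fps_mulDl : left_distributive fps_mul +%R.
Proof.
move=> f g h; apply/funext => n.
rewrite [RHS](_ : _ = fps_mul f h n + fps_mul g h n) // /fps_mul -big_split /=.
by apply: eq_bigr => i _; rewrite -mulrDl.
Qed.

Lemma fps_one_neq0 : fps_one != 0 :> fps K.
Proof. by apply/eqP => /(congr1 (@^~ 0%N))/eqP; rewrite oner_eq0. Qed.

HB.instance Definition _ := GRing.Zmodule_isComNzRing.Build (fps K)
  fps_mulA fps_mulC fps_mul1 fps_mulDl fps_one_neq0.

Definition fps_unit : {pred fps K} := fun f => `[< exists g, g * f = 1 >].
Definition fps_inv f : fps K :=
  if pselect (exists g, g * f = 1) is left e then projT1 (cid e) else f.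

Lemma fps_mulVf : {in fps_unit, left_inverse 1 fps_inv *%R}.
Proof.
move=> f /asboolP uf; rewrite /fps_inv; case: pselect => // e.
exact: (projT2 (cid e)).
Qed.

Lemma fps_unitP f g : g * f = 1 -> f \in fps_unit.
Proof. by move=> gf; apply/asboolP; exists g. Qed.

Lemma fps_inv_out : {in [predC fps_unit], fps_inv =1 id}.
Proof.
move=> f nuf; rewrite /fps_inv; case: pselect => // e.
by case/negP: nuf; apply/asboolP.
Qed.

HB.instance Definition _ := GRing.ComNzRing_hasMulInverse.Build (fps K)
  fps_mulVf fps_unitP fps_inv_out.
End FpsRing.

Definition restrict_scalars (A B : comNzRingType) (h : {rmorphism A -> B})
  (M : lmodType B) : Type := M.

Section RestrictScalars.
Variables (A B : comNzRingType) (h : {rmorphism A -> B}) (M : lmodType B).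
Local Notation N := (restrict_scalars h M).

HB.instance Definition _ := GRing.Zmodule.on N.

Definition restrict_scale (a : A) (m : N) : N := h a *: (m : M).

Lemma restrict_scalerA a b m :
  restrict_scale a (restrict_scale b m) = restrict_scale (a * b) m.
Proof. by rewrite /restrict_scale scalerA rmorphM. Qed.
Lemma restrict_scale1r : left_id 1 restrict_scale.
Proof. by move=> m; rewrite /restrict_scale rmorph1 scale1r. Qed.
Lemma restrict_scalerDr : right_distributive restrict_scale +%R.
Proof. by move=> a m n; rewrite /restrict_scale scalerDr. Qed.
Lemma restrict_scalerDl m : {morph restrict_scale^~ m : a b / a + b}.
Proof. by move=> a b; rewrite /restrict_scale rmorphD scalerDl. Qed.

HB.instance Definition _ := GRing.Zmodule_isLmodule.Build A N
  restrict_scalerA restrict_scale1r restrict_scalerDr restrict_scalerDl.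
End RestrictScalars.

Section Kernel.
Variables (A B : comNzRingType) (h : {rmorphism A -> B}).

Definition rker : {pred A^o} := fun a => h a == 0.

Lemma rker_submod_closed : submod_closed rker.
Proof.
split=> [|a u v]; rewrite !unfold_in ?rmorph0 // => /eqP hu /eqP hv.
by rewrite rmorphD rmorphM hu hv mulr0 addr0.
Qed.
HB.instance Definition _ := GRing.isSubmodClosed.Build A A^o rker rker_submod_closed.

Definition ker_module : Type := {a : A^o | a \in rker}.
HB.instance Definition _ := SubChoice.on ker_module.
HB.instance Definition _ := [SubChoice_isSubLmodule of ker_module by <:].
End Kernel.

Section FiberProduct.
Variables (A B D : comNzRingType).
Variables (f : {rmorphism A -> D}) (g : {rmorphism B -> D}).

Definition fiber_pred : {pred A * B} := fun p => f p.1 == g p.2.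

Lemma fiber_subring_closed : subring_closed fiber_pred.
Proof.
split=> [|p q|p q]; rewrite !unfold_in ?rmorph1 // => /eqP fp /eqP fq.
  by rewrite !rmorphB fp fq.
by rewrite !rmorphM fp fq.
Qed.
HB.instance Definition _ :=
  GRing.isSubringClosed.Build (A * B)%type fiber_pred fiber_subring_closed.

Definition fiber_product : Type := {p : A * B | p \in fiber_pred}.
HB.instance Definition _ := SubChoice.on fiber_product.
HB.instance Definition _ := [SubChoice_isSubComNzRing of fiber_product by <:].

Definition fiber_fst : fiber_product -> A := fst \o val.
Definition fiber_snd : fiber_product -> B := snd \o val.
HB.instance Definition _ := GRing.RMorphism.on fiber_fst.
HB.instance Definition _ := GRing.RMorphism.on fiber_snd.
End FiberProduct.

(* A resolution ... -> A^(b 1) -> A^(b 0) -> M -> 0 of M by free modules of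
   finite rank.  Matrices act on row vectors from the right. *)
Record free_resolution (A : comNzRingType) (M : lmodType A) := FreeResolution {
  fr_rank : nat -> nat;
  fr_diff : forall i, 'M[A]_(fr_rank i.+1, fr_rank i);
  fr_aug : {linear 'rV[A]_(fr_rank 0) -> M};
  fr_aug_surj : forall m, exists v, fr_aug v = m;
  fr_exact0 : forall v, fr_aug v = 0 <-> exists w, v = w *m fr_diff 0;
  fr_exact : forall i (v : 'rV[A]_(fr_rank i.+1)),
    v *m fr_diff i = 0 <-> exists w, v = w *m fr_diff i.+1
}.

Section Betti.
(* k is an A-module through res. *)
Variables (k : fieldType) (A : comNzRingType) (res : {rmorphism A -> k}).

(* F_j (x)_A k = k^(b j), with differentials map_mx res (fr_diff F j); this is
   the dimension of the i-th homology, cycles modulo boundaries. *)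
Definition tor_dim (M : lmodType A) (F : free_resolution M) (i : nat) : nat :=
  (match i with
   | 0 => fr_rank F 0
   | j.+1 => \rank (kermx (map_mx res (fr_diff F j)))
   end - \rank (map_mx res (fr_diff F i)))%N.

(* dim_k Tor_i^A(M, k); tor_dim does not depend on the resolution.  The value is
   0 when M has no resolution by finite free modules, which does not happen for
   a finitely generated module over a Noetherian ring. *)
Definition betti (M : lmodType A) (i : nat) : nat :=
  xget 0%N [set b | exists F : free_resolution M, b = tor_dim F i].

Definition poincare (M : lmodType A) : fps int := fun i => (betti M i)%:Z.
End Betti.

(* The series P^A_B of B, regarded as an A-module through h : A -> B. *)
Definition poincare_hom (k : fieldType) (A B : comNzRingType)
    (res : {rmorphism A -> k}) (h : {rmorphism A -> B}) : fps int :=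
  poincare res (restrict_scalars h B^o).

(* A / I as an A-module.  The ideals of type idealr A are proper. *)
Definition quot_module (A : comNzRingType) (I : idealr A) : lmodType A :=
  @restrict_scalars A {ideal_quot I} \pi_{ideal_quot I} {ideal_quot I}^o.

Definition radical (A : comNzRingType) (I : idealr A) : Prop :=
  forall (a : A) n, a ^+ n \in I -> a \in I.

Definition onto (A B : Type) (h : A -> B) : Prop := forall b, exists a, h a = b.

Definition large (k : fieldType) (A B : comNzRingType)
    (resA : {rmorphism A -> k}) (resB : {rmorphism B -> k})
    (h : {rmorphism A -> B}) : Prop :=
  onto h /\
  forall I : idealr B, radical I ->
    poincare resA (restrict_scalars h (quot_module I)) =
    poincare resB (quot_module I) * poincare_hom resA h.

Definition Cplx (R : realType) : numClosedFieldType := R[i].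

Section Analytic.
Variables (R : realType) (n : nat).
Local Notation K := (Cplx R).
Implicit Types (x y w : 'rV[K]_n) (c d : {ffun 'I_n -> nat} -> K).
Local Notation mi := {ffun 'I_n -> nat}.

(* of_box embeds the multi-indices with all entries < N. *)
Definition of_box N (k : {ffun 'I_n -> 'I_N}) : {ffun 'I_n -> nat} :=
  [ffun l => k l : nat].
Definition mdegree (k : mi) : nat := (\sum_l k l)%N.
Definition mpow w (k : mi) : K := \prod_l w 0 l ^+ k l.
Definition box_sum c w (N : nat) : K :=
  \sum_(k : {ffun 'I_n -> 'I_N}) c (of_box k) * mpow w (of_box k).

Definition series_sum c w (a : K) : Prop := box_sum c w @ \oo --> a.

(* f is the sum, near x, of a convergent power series in y - x.  The Cauchy
   bound makes the series absolutely convergent near x, so that the choice of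
   the partial sums over boxes is immaterial. *)
Definition analytic_at x (f : 'rV[K]_n -> K) : Prop :=
  exists (c : {ffun 'I_n -> nat} -> K) (r M : K),
    [/\ 0 < r,
        forall k, `|c k| * r ^+ mdegree k <= M &
        \forall y \near x, series_sum c (y - x) (f y)].

Definition madd (i j : mi) : {ffun 'I_n -> nat} := [ffun l => (i l + j l)%N].
Definition msub (i j : mi) : {ffun 'I_n -> nat} := [ffun l => (i l - j l)%N].
Definition mle (i j : mi) : bool := [forall l, (i l <= j l)%N].
Definition in_box N (k : mi) : bool := [forall l, (k l < N)%N].

Definition conv_term c d (k i : mi) : K :=
  if mle i k then c i * d (msub k i) else 0.
Definition conv_box N c d (k : mi) : K :=
  \sum_(i : {ffun 'I_n -> 'I_N}) conv_term c d k (of_box i).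
Definition conv c d (k : mi) : K := conv_box (mdegree k).+1 c d k.

Lemma of_box_inj N : injective (@of_box N).
Proof.
move=> i j /ffunP ij; apply/ffunP => l.
by apply: val_inj; have := ij l; rewrite !ffunE.
Qed.

Lemma in_boxP N (k : mi) : reflect (exists i : {ffun 'I_n -> 'I_N}, k = of_box i) (in_box N k).
Proof.
apply: (iffP forallP) => [h|[i ->] l]; last by rewrite ffunE.
by exists [ffun l => Ordinal (h l)]; apply/ffunP => l; rewrite !ffunE.
Qed.

Lemma in_box_mdegree k : in_box (mdegree k).+1 k.
Proof. by apply/forallP => l; rewrite ltnS /mdegree (bigD1 l) //= leq_addr. Qed.

Lemma mdegreeD i j : mdegree (madd i j) = (mdegree i + mdegree j)%N.
Proof. by rewrite /mdegree -big_split; apply: eq_bigr => l _; rewrite ffunE. Qed.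

Lemma mpowD w i j : mpow w (madd i j) = mpow w i * mpow w j.
Proof. by rewrite /mpow -big_split; apply: eq_bigr => l _; rewrite ffunE exprD. Qed.

Lemma maddK i k : mle i k -> madd i (msub k i) = k.
Proof. by move=> /forallP h; apply/ffunP => l; rewrite !ffunE subnKC. Qed.

Lemma maddKl i j : msub (madd i j) i = j.
Proof. by apply/ffunP => l; rewrite !ffunE addKn. Qed.

Lemma mle_madd i j : mle i (madd i j).
Proof. by apply/forallP => l; rewrite ffunE leq_addr. Qed.

Lemma box_widen N N' (F : {ffun 'I_n -> nat} -> K) : (N <= N')%N ->
  (forall k, ~~ in_box N.+1 k -> F k = 0) ->
  \sum_(k : {ffun 'I_n -> 'I_N'.+1}) F (of_box k) =
  \sum_(k : {ffun 'I_n -> 'I_N.+1}) F (of_box k).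
Proof.
move=> NN' F0.
have lt (k : {ffun 'I_n -> 'I_N.+1}) l : (k l < N'.+1)%N.
  by apply: leq_trans (ltn_ord _) _.
rewrite (bigID (fun k : {ffun 'I_n -> 'I_N'.+1} => in_box N.+1 (of_box k))) /=.
rewrite [X in _ + X]big1 ?addr0; last by move=> k; exact: F0.
rewrite (reindex_onto
  (fun k : {ffun 'I_n -> 'I_N.+1} => [ffun l => inord (k l) : 'I_N'.+1])
  (fun k => [ffun l => inord (k l)])) /=; last first.
  move=> k /forallP kN; apply/ffunP => l; have := kN l; rewrite !ffunE => kl.
  by apply: val_inj; rewrite /= !inordK // inordK.
apply: eq_big => [k|k _].
  apply/andP; split; first by apply/forallP => l; rewrite !ffunE inordK.
  apply/eqP/ffunP => l; rewrite !ffunE; apply: val_inj.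
  by rewrite /= inordK inordK.
by congr F; apply/ffunP => l; rewrite !ffunE inordK.
Qed.

Lemma conv_boxE N N' c d k : in_box N.+1 k -> in_box N'.+1 k ->
  conv_box N.+1 c d k = conv_box N'.+1 c d k.
Proof.
wlog NN' : N N' / (N <= N')%N.
  by case: (leqP N N') => [? h|/ltnW le h kN kN']; [exact: h|rewrite (h _ _ le)].
move=> kN kN'; rewrite /conv_box (box_widen NN') // => i iN.
rewrite /conv_term ifF //; apply/negbTE; apply: contra iN => /forallP ik.
by apply/forallP => l; apply: leq_ltn_trans (ik l) _; exact: (forallP kN).
Qed.

Lemma conv_boxEj N c d k : in_box N k ->
  conv_box N c d k = \sum_(i : {ffun 'I_n -> 'I_N}) \sum_(j : {ffun 'I_n -> 'I_N} |
    madd (of_box i) (of_box j) == k) c (of_box i) * d (of_box j).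
Proof.
move=> kN; apply: eq_bigr => i _; rewrite /conv_term; case: ifPn => [ik|ik].
  have /in_boxP[j jE] : in_box N (msub k (of_box i)).
    apply/forallP => l; rewrite ffunE; apply: leq_ltn_trans (leq_subr _ _) _.
    exact: (forallP kN).
  rewrite (big_pred1 j) ?jE // => j'; rewrite /= -(inj_eq (@of_box_inj N)) -jE.
  apply/eqP/eqP => [<-|->]; first by rewrite maddKl.
  exact: maddK.
rewrite big_pred0 // => j; apply/negbTE; apply: contra ik => /eqP <-.
exact: mle_madd.
Qed.

Lemma box_sum_conv c d w N :
  box_sum (conv c d) w N.+1 =
  \sum_(i : {ffun 'I_n -> 'I_N.+1}) \sum_(j : {ffun 'I_n -> 'I_N.+1} |
    in_box N.+1 (madd (of_box i) (of_box j)))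
      (c (of_box i) * mpow w (of_box i)) * (d (of_box j) * mpow w (of_box j)).
Proof.
pose F i j := (c i * mpow w i) * (d j * mpow w j).
pose B := {ffun 'I_n -> 'I_N.+1}.
transitivity (\sum_(k : B) \sum_(i : B) \sum_(j : B |
    madd (of_box i) (of_box j) == of_box k) F (of_box i) (of_box j)).
  apply: eq_bigr => k _; have kN : in_box N.+1 (of_box k) by apply/in_boxP; exists k.
  rewrite /conv (conv_boxE _ _ (in_box_mdegree _) kN) conv_boxEj // mulr_suml.
  apply: eq_bigr => i _; rewrite mulr_suml; apply: eq_bigr => j /eqP <-.
  by rewrite mpowD /F mulrACA.
rewrite exchange_big; apply: eq_bigr => i _; rewrite [RHS]big_mkcond /=.
under eq_bigr do rewrite big_mkcond.
rewrite exchange_big; apply: eq_bigr => j _ /=.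
case: ifPn => [/in_boxP[k kE]|h].
  rewrite -big_mkcond (big_pred1 k) // => k'.
  by rewrite /= kE (inj_eq (@of_box_inj _)) eq_sym.
rewrite big1 // => k _; case: eqP => // e.
by case/negP: h; apply/in_boxP; exists k.
Qed.

Lemma norm_mpow_le w (r : K) (k : mi) : (forall l, `|w 0 l| <= r) ->
  `|mpow w k| <= r ^+ mdegree k.
Proof.
move=> wr; rewrite /mpow normr_prod /mdegree expr_sum.
apply: ler_prod => l _; rewrite normr_ge0 /= normrX.
by apply: lerXn2r; rewrite ?nnegrE ?(le_trans _ (wr l)).
Qed.

Lemma sum_half_le N :
  \sum_(i : {ffun 'I_n -> 'I_N}) (2^-1 : K) ^+ mdegree (of_box i) <= 2 ^+ n.
Proof.
have -> : \sum_(i : {ffun 'I_n -> 'I_N}) (2^-1 : K) ^+ mdegree (of_box i) =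
    \prod_(l < n) \sum_(a < N) (2^-1) ^+ a.
  rewrite bigA_distr_bigA; apply: eq_bigr => i _.
  by rewrite /mdegree expr_sum; apply: eq_bigr => l _; rewrite ffunE.
rewrite -[in X in _ <= X](card_ord n) -prodr_const; apply: ler_prod => l _.
rewrite sumr_ge0 //=; last by move=> a _; rewrite exprn_ge0 // invr_ge0.
have h : \sum_(a < N) (2^-1) ^+ a + 2 * 2^-1 ^+ N = 2 :> K.
  elim: N => [|N IH]; first by rewrite big_ord0 add0r mulr1.
  by rewrite big_ord_recr /= exprS mulVKf ?pnatr_eq0 // -[RHS]IH -addrA mulr_natl mulr2n.
by rewrite -[X in _ <= X]h lerDl mulr_ge0 // exprn_ge0 // invr_ge0.
Qed.

Lemma box_sum_mul_bound c d (r M M' : K) w N : 0 < r ->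
  (forall k, `|c k| * r ^+ mdegree k <= M) ->
  (forall k, `|d k| * r ^+ mdegree k <= M') ->
  (forall l, `|w 0 l| <= r / 4) ->
  `|box_sum c w N.+1 * box_sum d w N.+1 - box_sum (conv c d) w N.+1|
    <= M * M' * 4 ^+ n * 2^-1 ^+ N.+1.
Proof.
move=> r0 cM dM wr; pose B := {ffun 'I_n -> 'I_N.+1}.
have term (e : mi -> K) L : (forall k, `|e k| * r ^+ mdegree k <= L) ->
    forall k, `|e k * mpow w k| <= L * 4^-1 ^+ mdegree k.
  move=> eL k; rewrite normrM.
  apply: (@le_trans _ _ (`|e k| * (r / 4) ^+ mdegree k)).
    by rewrite ler_wpM2l // norm_mpow_le.
  by rewrite exprMn mulrA ler_wpM2r // exprn_ge0 // invr_ge0.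
have M0 (e : mi -> K) L : (forall k, `|e k| * r ^+ mdegree k <= L) -> 0 <= L.
  by move=> eL; apply: le_trans (eL [ffun=> 0%N]); rewrite mulr_ge0 // exprn_ge0 // ltW.
have Mc := M0 _ _ cM; have Md := M0 _ _ dM.
have -> : box_sum c w N.+1 * box_sum d w N.+1 - box_sum (conv c d) w N.+1 =
  \sum_(i : B) \sum_(j : B | ~~ in_box N.+1 (madd (of_box i) (of_box j)))
      (c (of_box i) * mpow w (of_box i)) * (d (of_box j) * mpow w (of_box j)).
  rewrite box_sum_conv /box_sum mulr_suml -sumrB; apply: eq_bigr => i _.
  rewrite mulr_sumr (bigID (fun j : B => in_box N.+1 (madd (of_box i) (of_box j)))) /=.
  by rewrite addrC addrK.
have half4 m : 4^-1 ^+ m = 2^-1 ^+ m * 2^-1 ^+ m :> K.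
  by rewrite -exprMn -invfM -natrM.
apply: (@le_trans _ _ (\sum_(i : B) \sum_(j : B)
    M * M' * 2^-1 ^+ N.+1 * (2^-1 ^+ mdegree (of_box i) * 2^-1 ^+ mdegree (of_box j)))).
  apply: le_trans (ler_norm_sum _ _ _) _; apply: ler_sum => i _.
  apply: le_trans (ler_norm_sum _ _ _) _; rewrite [X in X <= _]big_mkcond /=.
  have h0 m : 0 <= 2^-1 ^+ m :> K by rewrite exprn_ge0 // invr_ge0.
  apply: ler_sum => j _; case: ifPn => [|_]; last by rewrite !mulr_ge0.
  rewrite negb_forall => /existsP[l]; rewrite -leqNgt => Nl.
  have Nd : (N.+1 <= mdegree (of_box i) + mdegree (of_box j))%N.
    by rewrite -mdegreeD; apply: leq_trans Nl _; rewrite /mdegree (bigD1 l) //= leq_addr.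
  rewrite normrM; apply: le_trans (ler_pM _ _ (term _ _ cM _) (term _ _ dM _)) _ => //.
  rewrite mulrACA -!mulrA ler_wpM2l // ler_wpM2l //.
  rewrite -[X in X <= _]exprD half4 -[X in _ <= _ * X]exprD ler_wpM2r //.
  by apply: ler_wiXn2l => //; rewrite ?invr_ge0 // invf_le1 ?ltr0n // ler1n.
rewrite -[X in _ <= X]mulrA [4 ^+ n * _]mulrC mulrA.
under eq_bigr do rewrite -mulr_sumr.
rewrite -mulr_sumr ler_wpM2l ?mulr_ge0 ?exprn_ge0 ?invr_ge0 //.
under eq_bigr do rewrite -mulr_sumr.
rewrite -mulr_suml -[4%:R]/((2 * 2)%:R) natrM exprMn.
have h0 : 0 <= \sum_(i : B) 2^-1 ^+ mdegree (of_box i) :> K.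
  by apply: sumr_ge0 => i _; rewrite exprn_ge0 // invr_ge0.
by apply: ler_pM => //; exact: sum_half_le.
Qed.

Lemma bound_weaken c (r t M : K) : 0 < t -> t <= r ->
  (forall k, `|c k| * r ^+ mdegree k <= M) ->
  forall k, `|c k| * t ^+ mdegree k <= M.
Proof.
move=> t0 tr cM k; apply: le_trans (cM k); rewrite ler_wpM2l //.
by apply: lerXn2r; rewrite // nnegrE ltW // (lt_le_trans t0).
Qed.

Lemma common_radius (r s : K) : 0 < r -> 0 < s ->
  exists t : K, [/\ 0 < t, t <= r & t <= s].
Proof.
move=> r0 s0; exists (r * s / (r + s)); split.
- by rewrite divr_gt0 ?mulr_gt0 ?addr_gt0.
- by rewrite ler_pdivrMr ?addr_gt0 // ler_pM2l // lerDr ltW.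
- by rewrite ler_pdivrMr ?addr_gt0 // mulrC ler_pM2l // lerDl ltW.
Qed.

Lemma conv_bound c d (r M M' : K) : 0 < r ->
  (forall k, `|c k| * r ^+ mdegree k <= M) ->
  (forall k, `|d k| * r ^+ mdegree k <= M') ->
  forall k, `|conv c d k| * (r / 2 ^+ n) ^+ mdegree k <= M * M'.
Proof.
move=> r0 cM dM k; set m := mdegree k; pose B := {ffun 'I_n -> 'I_m.+1}.
have h0 (e : mi -> K) i : 0 <= `|e i| * r ^+ mdegree i.
  by rewrite mulr_ge0 // exprn_ge0 // ltW.
have Mc : 0 <= M := le_trans (h0 c k) (cM k).
have Md : 0 <= M' := le_trans (h0 d k) (dM k).
have h : `|conv c d k| * r ^+ m <= (M * M') *+ #|B|.
  rewrite -sumr_const; apply: le_trans (ler_wpM2r _ (ler_norm_sum _ _ _)) _.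
    by rewrite exprn_ge0 // ltW.
  rewrite mulr_suml; apply: ler_sum => i _; rewrite /conv_term.
  case: ifPn => [ik|_]; last by rewrite normr0 mul0r mulr_ge0.
  have -> : m = (mdegree (of_box i) + mdegree (msub k (of_box i)))%N.
    by rewrite -mdegreeD maddK.
  by rewrite normrM exprD mulrACA; apply: ler_pM.
rewrite exprMn mulrA; apply: le_trans (ler_wpM2r _ h) _.
  by rewrite exprn_ge0 // invr_ge0 exprn_ge0.
rewrite card_ffun !card_ord -[M * M' *+ _]mulr_natr -[X in X <= _]mulrA -[X in _ <= X]mulr1.
rewrite ler_wpM2l ?mulr_ge0 // exprVn ler_pdivrMr ?exprn_gt0 // mul1r.
rewrite -exprM mulnC exprM natrX; apply: lerXn2r; rewrite ?nnegrE ?exprn_ge0 //.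
by rewrite -natrX ler_nat ltn_expl.
Qed.

Lemma half_lt (e : K) : 0 < e -> exists N, (2^-1 : K) ^+ N < e.
Proof.
move=> e0; have eE : e = (complex.Re e)%:C%C.
  by move: e0; case: e => a b; rewrite ltcE /= => /andP[/eqP -> _].
have a0 : 0 < complex.Re e by move: e0; rewrite ltcE => /andP[].
exists (Num.bound (complex.Re e)^-1).
set N := Num.bound _.
have -> : (2^-1 : K) ^+ N = ((2^-1 : R) ^+ N)%:C%C.
  by rewrite rmorphXn fmorphV rmorph_nat.
rewrite [ltRHS]eE ltcR exprVn invf_plt ?posrE ?exprn_gt0 //.
exact: upper_nthrootP.
Qed.

Lemma analytic_cst x (a : K) : analytic_at x (fun=> a).
Proof.
pose z : mi := [ffun=> 0%N].
exists (fun k => if k == z then a else 0), 1, `|a|; split => //.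
  by move=> k; rewrite expr1n mulr1; case: ifP; rewrite ?normr0.
near=> y; apply: cvg_near_cst; near=> N.
have N0 : (0 < N)%N by near: N; exists 1%N.
rewrite /box_sum (bigD1 [ffun=> Ordinal N0]) //= big1 => [|k kz].
  rewrite addr0 ifT; last by apply/eqP/ffunP => l; rewrite !ffunE.
  by rewrite /mpow big1 ?mulr1 // => l _; rewrite !ffunE.
rewrite ifF ?mul0r //; apply: contra_neqF kz => /eqP kz; apply: of_box_inj.
by rewrite kz; apply/ffunP => l; rewrite !ffunE.
Unshelve. all: by end_near. Qed.

Lemma analytic_sub x f g : analytic_at x f -> analytic_at x g ->
  analytic_at x (f - g).
Proof.
move=> [c [r [M [r0 cM cf]]]] [d [s [M' [s0 dM dg]]]].
have [t [t0 tr ts]] := common_radius r0 s0.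
have {}cM := bound_weaken t0 tr cM; have {}dM := bound_weaken t0 ts dM.
exists (fun k => c k - d k), t, (M + M'); split; [exact: t0|move=> k|].
  apply: le_trans (lerD (cM k) (dM k)); rewrite -mulrDl.
  by rewrite ler_wpM2r ?ler_normB // exprn_ge0 // ltW.
move: cf dg; apply: filterS2 => y cy dy.
have E : box_sum (fun k => c k - d k) (y - x) =
    (fun N => box_sum c (y - x) N - box_sum d (y - x) N).
  apply/funext => N; rewrite /box_sum -sumrB.
  by apply: eq_bigr => k _; rewrite mulrBl.
by rewrite /series_sum E; exact: cvgB cy dy.
Qed.

Lemma analytic_mul x f g : analytic_at x f -> analytic_at x g ->
  analytic_at x (f * g).
Proof.
move=> [c [r [M [r0 cM cf]]]] [d [s [M' [s0 dM dg]]]].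
have [t [t0 tr ts]] := common_radius r0 s0.
have {}cM := bound_weaken t0 tr cM; have {}dM := bound_weaken t0 ts dM.
exists (conv c d), (t / 2 ^+ n), (M * M'); split.
- by rewrite divr_gt0 // exprn_gt0.
- exact: conv_bound.
have xt : \forall y \near x, forall l, `|(y - x) 0 l| <= t / 4.
  apply/nbhs_ballP; exists (t / 4) => /= [|y xy l]; first exact: divr_gt0.
  by rewrite !mxE distrC; apply/ltW; exact: xy.2.
move: cf dg xt; apply: filterS3 => y cy dy yx.
have e0 : (fun N => box_sum c (y - x) N * box_sum d (y - x) N -
    box_sum (conv c d) (y - x) N) @ \oo --> (0 : K).
  apply/cvgr0Pnorm_lt => e e0.
  pose L := `|M * M' * 4 ^+ n| + 1.
  have L0 : 0 < L by rewrite ltr_wpDl.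
  have [N0 hN] := half_lt (divr_gt0 e0 L0).
  exists N0.+1 => // -[//|N] /= NN0.
  have B := box_sum_mul_bound N t0 cM dM yx; apply: (le_lt_trans B).
  apply: le_lt_trans (_ : L * 2^-1 ^+ N0 < e); last first.
    by rewrite mulrC -ltr_pdivlMr.
  have B0 : 0 <= M * M' * 4 ^+ n.
    rewrite !mulr_ge0 ?exprn_ge0 //.
    - by apply: le_trans (cM [ffun=> 0%N]); rewrite mulr_ge0 ?exprn_ge0 // ltW.
    - by apply: le_trans (dM [ffun=> 0%N]); rewrite mulr_ge0 ?exprn_ge0 // ltW.
  apply: ler_pM; rewrite ?exprn_ge0 ?invr_ge0 // /L ?ger0_norm ?lerDl //.
  by apply: ler_wiXn2l; rewrite ?invr_ge0 // ?invf_le1 ?ltr0n ?ler1n // ltnW.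
pose S N := box_sum c (y - x) N * box_sum d (y - x) N.
have E : box_sum (conv c d) (y - x) =
    (fun N => S N - (S N - box_sum (conv c d) (y - x) N)).
  by apply/funext => N; rewrite subKr.
rewrite /series_sum E -[X in _ --> X]subr0.
by apply: cvgB e0; exact: cvgM cy dy.
Qed.
End Analytic.

Section Germs.
Variable R : realType.
Local Notation K := (Cplx R).

Definition analytic_pred n (x : 'rV[K]_n) : {pred 'rV[K]_n -> K} :=
  fun f => `[< analytic_at x f >].

Lemma analytic_subring_closed n (x : 'rV[K]_n) :
  subring_closed (analytic_pred x).
Proof.
split=> [|f g|f g]; rewrite !unfold_in.
- exact/asboolP/analytic_cst.
- by move=> /asboolP fx /asboolP gx; exact/asboolP/analytic_sub.
- by move=> /asboolP fx /asboolP gx; exact/asboolP/analytic_mul.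
Qed.
HB.instance Definition _ n (x : 'rV[K]_n) := GRing.isSubringClosed.Build
  ('rV[K]_n -> K) (analytic_pred x) (analytic_subring_closed x).

(* Functions are defined on the whole of C^n, but only their germs at x matter:
   see local_ring. *)
Definition holo n (x : 'rV[K]_n) : Type :=
  {f : 'rV[K]_n -> K | f \in analytic_pred x}.
HB.instance Definition _ n (x : 'rV[K]_n) := SubChoice.on (holo x).
HB.instance Definition _ n (x : 'rV[K]_n) :=
  [SubChoice_isSubComNzRing of holo x by <:].

(* The germ at germ_pt of a set that is, near that point, the zero locus of
   finitely many holomorphic functions. *)
Record germ (n : nat) := Germ {
  germ_set : set 'rV[K]_n;
  germ_pt : 'rV[K]_n;
  germ_ptP : germ_set germ_pt;
  germ_analytic : exists (p : nat) (f : 'I_p -> 'rV[K]_n -> K),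
    (forall i, analytic_at germ_pt (f i)) /\
    \forall u \near germ_pt, germ_set u <-> forall i, f i u = 0
}.

Section LocalRing.
Variables (n : nat) (X : germ n).

Definition vanishes (f : holo (germ_pt X)) : Prop :=
  \forall u \near germ_pt X, germ_set X u -> val f u = 0.

Definition vanishing : {pred holo (germ_pt X)} := fun f => `[< vanishes f >].

Lemma vanishing_idealr_closed : idealr_closed vanishing.
Proof.
split=> [||a f g]; rewrite !unfold_in.
- by apply/asboolP; rewrite /vanishes; near=> u.
- apply/asboolP => /nbhs_singleton /(_ (germ_ptP X)) /eqP.
  by rewrite oner_eq0.
- move=> /asboolP f0 /asboolP g0; apply/asboolP; move: f0 g0.
  apply: filterS2 => u f0 g0 Xu.
  by rewrite -[LHS]/(val a u * val f u + val g u) f0 // g0 // mulr0 addr0.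
Unshelve. all: by end_near. Qed.
HB.instance Definition _ :=
  isIdealr.Build (holo (germ_pt X)) vanishing vanishing_idealr_closed.

(* O_{X,x} = O_{C^n,x} / I_{X,x}, obtained in one step by identifying the
   functions holomorphic at x that agree on X near x. *)
Definition local_ring : comNzRingType := {ideal_quot vanishing}.

Definition germ_class (f : holo (germ_pt X)) : local_ring :=
  \pi_{ideal_quot vanishing} f.

Lemma germ_classP (f g : holo (germ_pt X)) :
  germ_class f = germ_class g <->
  \forall u \near germ_pt X, germ_set X u -> val f u = val g u.
Proof.
split=> [/eqP|fg].
  rewrite -Quotient.idealrBE unfold_in => /asboolP; apply: filterS => u fg Xu.
  by apply/eqP; rewrite -subr_eq0; apply/eqP; exact: fg.
apply/eqP; rewrite -Quotient.idealrBE unfold_in; apply/asboolP.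
by move: fg; apply: filterS => u fg Xu; apply/eqP; rewrite subr_eq0 fg.
Qed.

Definition germ_eval (a : local_ring) : K :=
  val (repr (a : {ideal_quot vanishing})) (germ_pt X).

Lemma germ_evalE f : germ_eval (germ_class f) = val f (germ_pt X).
Proof.
have /germ_classP/nbhs_singleton : germ_class (repr (germ_class f : {ideal_quot vanishing})) = germ_class f.
  exact: reprK.
by apply; exact: germ_ptP.
Qed.

Lemma germ_classW (a : local_ring) : exists f, a = germ_class f.
Proof. by exists (repr (a : {ideal_quot vanishing})); rewrite /germ_class reprK. Qed.

HB.instance Definition _ :=
  GRing.RMorphism.copy germ_class (\pi_{ideal_quot vanishing}).

Lemma germ_eval_zmod_morphism : zmod_morphism germ_eval.
Proof.
move=> a b; have [f ->] := germ_classW a; have [g ->] := germ_classW b.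
by rewrite -rmorphB !germ_evalE.
Qed.
Lemma germ_eval_monoid_morphism : monoid_morphism germ_eval.
Proof.
split=> [|a b]; first by rewrite -(rmorph1 germ_class) germ_evalE.
have [f ->] := germ_classW a; have [g ->] := germ_classW b.
by rewrite -rmorphM !germ_evalE.
Qed.
HB.instance Definition _ :=
  GRing.isZmodMorphism.Build local_ring K germ_eval germ_eval_zmod_morphism.
HB.instance Definition _ :=
  GRing.isMonoidMorphism.Build local_ring K germ_eval germ_eval_monoid_morphism.
End LocalRing.

(* A morphism of reduced complex spaces: a continuous map Z -> X such that the
   composites with holomorphic functions on X are holomorphic on Z, i.e. (taking
   for f the coordinate functions) the restriction of a holomorphic map. *)
Record germ_morphism n m (Z : germ n) (X : germ m) := GermMorphism {
  gm_fun : 'rV[K]_n -> 'rV[K]_m;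
  gm_pt : gm_fun (germ_pt Z) = germ_pt X;
  gm_cvg : gm_fun @ within (germ_set Z) (nbhs (germ_pt Z)) --> germ_pt X;
  gm_set : \forall u \near germ_pt Z, germ_set Z u -> germ_set X (gm_fun u);
  gm_holo : forall f, analytic_at (germ_pt X) f ->
    exists2 g, analytic_at (germ_pt Z) g &
      \forall u \near germ_pt Z, germ_set Z u -> g u = f (gm_fun u)
}.

Section Pullback.
Variables (n m : nat) (Z : germ n) (X : germ m) (F : germ_morphism Z X).

Definition is_pullback (f : holo (germ_pt X)) (g : holo (germ_pt Z)) : Prop :=
  \forall u \near germ_pt Z, germ_set Z u -> val g u = val f (gm_fun F u).

Lemma pullback_ex (a : local_ring X) :
  exists b : local_ring Z, exists f g,
    [/\ a = germ_class f, b = germ_class g & is_pullback f g].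
Proof.
have [f fE] := germ_classW a.
have [g ag gf] := gm_holo F (asboolP _ (valP f)).
by exists (germ_class (exist _ g (asboolT ag))), f, (exist _ g (asboolT ag)).
Qed.

Definition pullback (a : local_ring X) : local_ring Z := projT1 (cid (pullback_ex a)).

Lemma pullbackE f g : is_pullback f g -> pullback (germ_class f) = germ_class g.
Proof.
move=> fg; rewrite /pullback; case: cid => b /= [f' [g' [ff' -> fg']]].
have ff'Z : \forall u \near germ_pt Z, germ_set Z u ->
    val f (gm_fun F u) = val f' (gm_fun F u).
  have h : \forall u \near germ_pt Z, germ_set Z u ->
      germ_set X (gm_fun F u) -> val f (gm_fun F u) = val f' (gm_fun F u).
    by have /(gm_cvg F) := (germ_classP _ _).1 ff'.
  by move: h (gm_set F); apply: filterS2 => u h FX Zu; apply: h => //; exact: FX.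
apply/esym/germ_classP; move: fg fg' ff'Z; apply: filterS3 => u gf gf' ff'Z Zu.
by rewrite gf // gf' // ff'Z.
Qed.

Lemma pullbackW (a b : local_ring X) : exists f g f' g',
  [/\ a = germ_class f, b = germ_class f', is_pullback f g & is_pullback f' g'].
Proof.
have [_ [f [g [-> _ fg]]]] := pullback_ex a.
have [_ [f' [g' [-> _ fg']]]] := pullback_ex b.
by exists f, g, f', g'.
Qed.

Lemma pullback_zmod_morphism : zmod_morphism pullback.
Proof.
move=> a b; have [f [g [f' [g' [-> -> fg fg']]]]] := pullbackW a b.
rewrite -rmorphB (pullbackE fg) (pullbackE fg') -rmorphB; apply: pullbackE.
move: fg fg'; apply: filterS2 => u fg fg' Zu.
by rewrite -[LHS]/(val g u - val g' u) fg // fg'.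
Qed.

Lemma pullback_monoid_morphism : monoid_morphism pullback.
Proof.
split=> [|a b].
  rewrite -(rmorph1 (@germ_class _ X)) -(rmorph1 (@germ_class _ Z)).
  by apply: pullbackE; rewrite /is_pullback; near=> u.
have [f [g [f' [g' [-> -> fg fg']]]]] := pullbackW a b.
rewrite -rmorphM (pullbackE fg) (pullbackE fg') -rmorphM; apply: pullbackE.
move: fg fg'; apply: filterS2 => u fg fg' Zu.
by rewrite -[LHS]/(val g u * val g' u) fg // fg'.
Unshelve. all: by end_near. Qed.

HB.instance Definition _ := GRing.isZmodMorphism.Build
  (local_ring X) (local_ring Z) pullback pullback_zmod_morphism.
HB.instance Definition _ := GRing.isMonoidMorphism.Build
  (local_ring X) (local_ring Z) pullback pullback_monoid_morphism.
End Pullback.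

(* The pushout V of X <- Z -> Y enters through its local ring O_{V,v}. *)
Section Gluing.
Variables (n m l : nat) (X : germ n) (Y : germ m) (Z : germ l).
Variables (alpha : germ_morphism Z X) (beta : germ_morphism Z Y).

Definition gluing_ring : comNzRingType :=
  fiber_product (pullback alpha) (pullback beta).
Definition gluing_fst : {rmorphism gluing_ring -> local_ring X} :=
  @fiber_fst _ _ _ (pullback alpha) (pullback beta).
Definition gluing_snd : {rmorphism gluing_ring -> local_ring Y} :=
  @fiber_snd _ _ _ (pullback alpha) (pullback beta).
Definition gluing_eval : {rmorphism gluing_ring -> K} :=
  @germ_eval _ X \o gluing_fst.

Definition weakly_large_gluing : Prop :=
  poincare gluing_eval (restrict_scalars gluing_fst (ker_module (pullback alpha))) =
  poincare (@germ_eval _ X) (ker_module (pullback alpha)) *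
    poincare_hom gluing_eval gluing_fst.

Definition large_gluing : Prop :=
  large gluing_eval (@germ_eval _ X) gluing_fst.

Definition strongly_large_gluing : Prop :=
  large_gluing /\ large gluing_eval (@germ_eval _ Y) gluing_snd.
End Gluing.
End Germs.

(* Main.v *)
(** Write V for the local ring of the gluing, X, Y, Z for those of the three
    germs, K and L for the kernels of X -> Z and Y -> Z, and put a = P^V_X,
    b = P^V_Y, x = P^X_Z, z = P^Y_Z.  The kernels of V -> X, V -> Y and V -> Z
    are L, K and K x L, and P_(A/J) = 1 + t P_J for a proper ideal J, so that
    a + b = 1 + P^V_Z holds unconditionally.
    In the strongly large case P^V_Z = x a = z b, hence b (x + z - x z) = x,
    and P^V_W = P^Y_W b.
    In case (i) the map t |-> (phi t, t) is a ring section s of V -> Y.  If G is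
    a minimal resolution of M over Y and F one of Y over V, then s(G) is a
    complex of free V-modules and the total complex of s(G) (x) F is a minimal
    resolution of M over V; so P^V_M = P^Y_M b for every M.  Weak largeness
    gives b = 1 + (x - 1) a, while a = 1 + (z - 1) b, and again
    b (x + z - x z) = x.
    Betti numbers are read off resolutions by finite free modules, whose
    existence requires that the local ring of a germ be Noetherian.  This
    follows from a division theorem for convergent power series by finitely
    many divisors, whose leading exponents are supplied by Dickson's lemma;
    dividing 1 by a series that does not vanish at the origin shows that the
    ring is local. *)

Require Import Defs.
From HB Require Import structures.
From mathcomp Require Import all_boot all_order all_algebra ring_quotient.
From mathcomp Require Import complex.
From mathcomp Require Import all_classical reals topology normedtype sequences.
From mathcomp Require Import zify ring.

Set Implicit Arguments.
Unset Strict Implicit.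
Unset Printing Implicit Defensive.

Import Order.TTheory GRing.Theory Num.Theory.
Import numFieldNormedType.Exports.

Local Open Scope ring_scope.
Local Open Scope quotient_scope.

(** * Sequences by dependent choice *)

(** The type varies with the index to allow families of matrices whose sizes depend on the degree.
    [P] is the invariant that keeps the next choice possible. *)
Lemma dependent_choice_seq (T : nat -> Type) (P : forall i, T i -> Prop)
    (Q : forall i, T i -> T i.+1 -> Prop) :
  (exists x, P 0%N x) ->
  (forall i x, P i x -> exists y, Q i x y /\ P i.+1 y) ->
  exists f : forall i, T i, P 0%N (f 0%N) /\ forall i, Q i (f i) (f i.+1).
Proof.
move=> /cid[x0 Px0] step.
have next i (x : {x | P i x}) : {y : {y | P i.+1 y} | Q i (sval x) (sval y)}.
  case: x => x Px; have /cid[y [Qy Py]] := step i x Px.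
  by exists (exist _ y Py).
pose s := fix s i : {x | P i x} :=
  if i is j.+1 then sval (next j (s j)) else exist _ x0 Px0.
exists (fun i => sval (s i)); split=> [|i]; first exact: Px0.
exact: svalP (next i (s i)).
Qed.

Definition mk_linear (A : comNzRingType) (U V : lmodType A) (f : U -> V)
    (fL : linear f) : {linear U -> V} :=
  HB.pack f (GRing.isLinear.Build A U V *:%R f fL).

(** * Free resolutions and Betti numbers *)

Section Resolutions.
Variable A : comNzRingType.
Implicit Types M N : lmodType A.

Lemma fr_exact_mx M (F : free_resolution M) i n (X : 'M[A]_(n, fr_rank F i.+1)) :
  X *m fr_diff F i = 0 -> exists Y, X = Y *m fr_diff F i.+1.
Proof.
move=> X0.
have /choice[w wE] : forall j, exists w, row j X = w *m fr_diff F i.+1.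
  by move=> j; apply/fr_exact; rewrite -row_mul X0 linear0.
exists (\matrix_j w j); apply/row_matrixP => j.
by rewrite row_mul rowK wE.
Qed.

Lemma fr_exact0_mx M (F : free_resolution M) n (X : 'M[A]_(n, fr_rank F 0)) :
  (forall v, fr_aug F (v *m X) = 0) -> exists Y, X = Y *m fr_diff F 0.
Proof.
move=> X0.
have /choice[w wE] : forall j, exists w, row j X = w *m fr_diff F 0.
  by move=> j; apply/fr_exact0; rewrite rowE.
exists (\matrix_j w j); apply/row_matrixP => j.
by rewrite row_mul rowK wE.
Qed.

Lemma fr_diff_mul M (F : free_resolution M) i : fr_diff F i.+1 *m fr_diff F i = 0.
Proof.
apply/row_matrixP => j; rewrite row_mul row0; apply/fr_exact.
by exists (delta_mx 0 j); rewrite rowE.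
Qed.

Lemma fr_aug_diff M (F : free_resolution M) w : fr_aug F (w *m fr_diff F 0) = 0.
Proof. by apply/fr_exact0; exists w. Qed.

(** The identity of [M] is lifted degree by degree, free modules being projective. In positive
    degrees the invariant says that the differential of [F] followed by [x] lands in the cycles of
    [G]. *)
Lemma comparison M (F G : free_resolution M) :
  exists phi : forall i, 'M[A]_(fr_rank F i, fr_rank G i),
    (forall v, fr_aug G (v *m phi 0%N) = fr_aug F v) /\
    forall i, fr_diff F i *m phi i = phi i.+1 *m fr_diff G i.
Proof.
pose P i : 'M[A]_(fr_rank F i, fr_rank G i) -> Prop := match i with
  | 0 => fun x => forall v, fr_aug G (v *m x) = fr_aug F v
  | j.+1 => fun x => fr_diff F j.+1 *m x *m fr_diff G j = 0 end.
apply: (@dependent_choice_seq _ P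
  (fun i x y => fr_diff F i *m x = y *m fr_diff G i)) => [|[|i] x /= Px].
- have /choice[w wE] : forall j, exists w, fr_aug G w = fr_aug F (delta_mx 0 j).
    by move=> j; exact: fr_aug_surj.
  exists (\matrix_j w j) => v; rewrite /= [v in RHS]row_sum_delta mulmx_sum_row !linear_sum.
  by apply: eq_bigr => j _; rewrite rowK !linearZ wE.
- have [v|y yE] := @fr_exact0_mx _ G _ (fr_diff F 0 *m x).
    by rewrite mulmxA Px fr_aug_diff.
  by exists y; split=> //=; rewrite -mulmxA -yE mulmxA fr_diff_mul mul0mx.
- have [y yE] := fr_exact_mx Px.
  by exists y; split=> //=; rewrite -mulmxA -yE mulmxA fr_diff_mul mul0mx.
Qed.

Lemma null_homotopy M (F : free_resolution M)
    (theta : forall i, 'M[A]_(fr_rank F i, fr_rank F i)) :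
  (forall v, fr_aug F (v *m theta 0%N) = 0) ->
  (forall i, fr_diff F i *m theta i = theta i.+1 *m fr_diff F i) ->
  exists h : forall i, 'M[A]_(fr_rank F i, fr_rank F i.+1),
    theta 0%N = h 0%N *m fr_diff F 0 /\
    forall i, theta i.+1 = h i.+1 *m fr_diff F i.+1 + fr_diff F i *m h i.
Proof.
move=> th0 thd.
(* The first clause retains the equation in degree 0, which has no lower homotopy term. The second
   makes [theta i.+1 - fr_diff F i *m h] a matrix of cycles, so that the next [h] exists. *)
pose P i (h : 'M[A]_(fr_rank F i, fr_rank F i.+1)) :=
  (i = 0%N -> theta i = h *m fr_diff F i) /\
  fr_diff F i *m (theta i - h *m fr_diff F i) = 0.
pose Q i h (h' : 'M[A]_(fr_rank F i.+1, fr_rank F i.+2)) :=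
  theta i.+1 = h' *m fr_diff F i.+1 + fr_diff F i *m h.
have [||f [f0 fQ]] := @dependent_choice_seq _ P Q.
- have [y yE] := fr_exact0_mx th0.
  by exists y; split=> //; rewrite -yE subrr mulmx0.
- move=> i h [_ Ph].
  have [|y yE] := @fr_exact_mx _ F i _ (theta i.+1 - fr_diff F i *m h).
    by rewrite mulmxBl -thd -mulmxA -mulmxBr Ph.
  exists y; split; first by rewrite /Q -yE subrK.
  split=> //; rewrite -yE opprB addrC subrK mulmxA.
  by rewrite fr_diff_mul mul0mx.
- by exists f; split=> //; apply: f0.1.
Qed.

End Resolutions.

(** Up to boundaries [psi] undoes [phi] on the cycles [Z], so [phi] is injective on homology: a
    complement [H] of [D] in [Z] embeds into [Z'] and its image meets [D'] only in 0. *)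
Lemma homology_rank_le (k : fieldType) a b a' b' (Z : 'M[k]_b) (D : 'M_(a, b))
    (Z' : 'M[k]_b') (D' : 'M_(a', b')) (phi : 'M_(b, b')) (psi : 'M_(b', b)) :
  (D <= Z)%MS -> (D' <= Z')%MS -> (Z *m phi <= Z')%MS -> (D' *m psi <= D)%MS ->
  (Z *m (phi *m psi - 1%:M) <= D)%MS ->
  (\rank Z - \rank D <= \rank Z' - \rank D')%N.
Proof.
move=> DZ DZ' Zphi Dpsi hom; pose H := (Z :\: D)%MS.
have HZ : (H <= Z)%MS by exact: diffmxSl.
have HD : (H :&: D = 0)%MS by exact: capmx_diff.
have rH : (\rank Z - \rank D = \rank H)%N.
  have := mxrank_cap_compl Z D; rewrite (capmx_idPr DZ).
  by rewrite -/H => <-; rewrite addKn.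
have HinD n (u : 'M_(n, b)) : (u <= H)%MS -> (u *m phi *m psi <= D)%MS -> u = 0.
  move=> uH uD; apply/eqP; rewrite -submx0 -HD sub_capmx uH.
  have -> : u = u *m phi *m psi - u *m (phi *m psi - 1%:M).
    by rewrite mulmxBr mulmx1 mulmxA opprB addrC subrK.
  rewrite addmx_sub ?eqmx_opp //.
  by apply: submx_trans hom; apply: submxMr; exact: submx_trans uH HZ.
have HphiZ : (H *m phi <= Z')%MS by apply: submx_trans Zphi; exact: submxMr.
have r1 : (\rank (H *m phi) = \rank H)%N.
  have := mxrank_mul_ker H phi; rewrite (_ : (H :&: kermx phi)%MS = 0) ?mxrank0 ?addn0 //.
  apply: HinD; first exact: capmxSl.
  by rewrite (_ : _ *m phi = 0) ?mul0mx ?sub0mx //; apply/sub_kermxP; exact: capmxSr.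
have r2 : (H *m phi :&: D' = 0)%MS.
  have /submxP[w wE] := capmxSl (H *m phi) D'.
  rewrite wE mulmxA (_ : w *m H = 0) ?mul0mx //; apply: HinD; first exact: submxMl.
  rewrite -(mulmxA w) -wE; apply: submx_trans Dpsi; apply: submxMr; exact: capmxSr.
rewrite rH -r1 leq_subRL ?mxrankS // addnC -(mxrank_disjoint_sum r2).
by apply: mxrankS; rewrite addsmx_sub HphiZ.
Qed.

Section Tor.
Variables (k : fieldType) (A : comNzRingType) (res : {rmorphism A -> k}).
Implicit Types M N : lmodType A.
Local Notation "M ^res" := (map_mx res M) (at level 2, format "M ^res").

Definition cycles M (F : free_resolution M) i : 'M[k]_(fr_rank F i) :=
  match i with
  | 0 => 1%:M
  | j.+1 => kermx (fr_diff F j)^res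
  end.

Lemma tor_dimE M (F : free_resolution M) i :
  tor_dim res F i = (\rank (cycles F i) - \rank (fr_diff F i)^res)%N.
Proof. by case: i => //=; rewrite mxrank1. Qed.

Lemma boundary_cycle M (F : free_resolution M) i :
  ((fr_diff F i)^res <= cycles F i)%MS.
Proof.
case: i => [|i] /=; first exact: submx1.
by apply/sub_kermxP; rewrite -map_mxM fr_diff_mul map_mx0.
Qed.

(** Comparison maps in both directions compose to an endomorphism of [F] homotopic to the identity,
    and the homotopy survives reduction to [k]. By symmetry Betti numbers do not depend on the
    resolution. *)
Lemma tor_dim_le M (F G : free_resolution M) i :
  (tor_dim res F i <= tor_dim res G i)%N.
Proof.
have [phi [phi0 phiS]] := comparison F G.
have [psi [psi0 psiS]] := comparison G F.
have [||h [h0 hS]] := @null_homotopy _ _ F (fun i => phi i *m psi i - 1%:M).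
- by move=> v; rewrite mulmxBr linearB /= mulmx1 mulmxA psi0 phi0 subrr.
- move=> j; rewrite mulmxBr mulmxBl mulmx1 mul1mx !mulmxA phiS.
  by rewrite -!mulmxA psiS.
rewrite !tor_dimE.
apply: (@homology_rank_le _ _ _ _ _ _ _ _ _ (phi i)^res (psi i)^res).
- exact: boundary_cycle.
- exact: boundary_cycle.
- case: i => [|i] /=; first exact: submx1.
  apply/sub_kermxP; rewrite -mulmxA -map_mxM -phiS map_mxM mulmxA.
  by rewrite mulmx_ker mul0mx.
- by rewrite -map_mxM psiS map_mxM submxMl.
rewrite -map_mxM -(map_mx1 res) -map_mxB.
case: i => [|i] /=; first by rewrite h0 mul1mx map_mxM submxMl.
rewrite hS map_mxD !map_mxM mulmxDr mulmxA addmx_sub ?submxMl //.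
by rewrite mulmxA mulmx_ker mul0mx sub0mx.
Qed.

Lemma betti_tor_dim M (F : free_resolution M) i : betti res M i = tor_dim res F i.
Proof.
rewrite /betti; case: xgetP => [_ -> [G ->]|/(_ (tor_dim res F i)) []].
  by apply/eqP; rewrite eqn_leq !tor_dim_le.
by exists F.
Qed.

Lemma rank_diffs_le M (F : free_resolution M) i :
  (\rank (fr_diff F i.+1)^res + \rank (fr_diff F i)^res <= fr_rank F i.+1)%N.
Proof.
have := mxrankS (boundary_cycle F i.+1); rewrite /= mxrank_ker.
by rewrite leq_subRL ?rank_leq_row // addnC.
Qed.

Definition fps_X : fps int := fun n => (n == 1%N)%:R.

Lemma fps_X_mulE (f : fps int) n : (fps_X * f) n = if n is j.+1 then f j else 0.
Proof.
rewrite [LHS](_ : _ = \sum_(i < n.+1) fps_X i * f (n - i)%N) //.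
case: n => [|n]; first by rewrite big_ord1 mul0r.
rewrite big_ord_recl mul0r add0r big_ord_recl mul1r /= subSS subn0.
by rewrite big1 ?addr0 // => i _; rewrite mul0r.
Qed.

Section Shift.
Variables (M N : lmodType A) (quo : {linear A^o -> M}) (inc : {linear N -> A^o}).
Hypothesis quo_onto : onto quo.
Hypothesis inc_inj : injective inc.
Hypothesis quo_ker : forall a, quo a = 0 <-> exists u, a = inc u.
Hypothesis inc_res : forall u, res (inc u) = 0.
Variable F : free_resolution N.

Let rank i := if i is j.+1 then fr_rank F j else 1%N.
Let diff i : 'M[A]_(rank i.+1, rank i) :=
  match i with
  | 0 => \col_j inc (fr_aug F (delta_mx 0 j))
  | j.+1 => fr_diff F j
  end.

Let diff0E v : v *m diff 0 = (inc (fr_aug F v))%:M.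
Proof.
apply/matrixP => i j; rewrite !ord1 !mxE eqxx mulr1n.
rewrite [v in RHS]row_sum_delta !linear_sum.
by apply: eq_bigr => l _; rewrite mxE !linearZ.
Qed.

Let aug_linear : linear (fun v : 'rV[A]_(rank 0) => quo (v 0 0)).
Proof. by move=> a u v; rewrite !mxE -[a * _]/(a *: (u 0 0 : A^o)) linearP. Qed.

(** Splicing [F] with [A^o -> M] moves it up by one degree. The new first differential has entries
    in the image of [inc], which reduce to 0, so nothing cancels between degrees 0 and 1. *)
Lemma shift_resolution : exists G : free_resolution M,
  forall i, tor_dim res G i = if i is j.+1 then tor_dim res F j else 1%N.
Proof.
have surj m : exists v, mk_linear aug_linear v = m.
  by have [a <-] := quo_onto m; exists a%:M; rewrite /= mxE eqxx.
have ex0 v : mk_linear aug_linear v = 0 <-> exists w, v = w *m diff 0.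
  rewrite /= quo_ker; split=> [[u vu]|[w ->]].
    have [w wu] := fr_aug_surj F u; exists w.
    by rewrite diff0E wu -vu; exact: mx11_scalar.
  by exists (fr_aug F w); rewrite diff0E mxE eqxx.
have ex i (v : 'rV_(rank i.+1)) : v *m diff i = 0 <-> exists w, v = w *m diff i.+1.
  case: i v => [|i] v; last exact: fr_exact.
  rewrite diff0E -fr_exact0; split=> [/matrixP/(_ 0 0)|->].
    by rewrite !mxE eqxx mulr1n -[0](linear0 inc) => /inc_inj.
  by rewrite linear0 raddf0.
have res_diff0 : map_mx res (diff 0) = 0.
  by apply/matrixP => j l; rewrite !mxE inc_res.
exists (FreeResolution surj ex0 ex) => -[|[|i]]; rewrite /tor_dim; rewrite //=.
- by rewrite [map_mx _ _]res_diff0 mxrank0.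
- by rewrite [X in kermx X]res_diff0 mxrank_ker mxrank0 subn0.
Qed.

Lemma poincare_shift : poincare res M = 1 + fps_X * poincare res N.
Proof.
have [G GE] := shift_resolution.
apply/funext => i; rewrite [RHS](_ : _ = (i == 0%N)%:R + (fps_X * poincare res N) i) //.
rewrite fps_X_mulE /poincare (betti_tor_dim G) GE.
by case: i => [|i]; rewrite ?addr0 // (betti_tor_dim F) add0r.
Qed.

End Shift.

Section DirectSum.
Variables (M N : lmodType A) (F : free_resolution M) (G : free_resolution N).

Let rank i := (fr_rank F i + fr_rank G i)%N.
Let diff i : 'M[A]_(rank i.+1, rank i) := block_mx (fr_diff F i) 0 0 (fr_diff G i).

Let aug_linear : linear (fun v : 'rV[A]_(rank 0) =>
  (fr_aug F (lsubmx v), fr_aug G (rsubmx v)) : (M * N)%type).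
Proof. by move=> a u v; rewrite !linearP. Qed.

Lemma sum_resolution : exists H : free_resolution (M * N)%type,
  forall i, tor_dim res H i = (tor_dim res F i + tor_dim res G i)%N.
Proof.
have surj m : exists v, mk_linear aug_linear v = m.
  case: m => m n; have [v vm] := fr_aug_surj F m; have [w wn] := fr_aug_surj G n.
  by exists (row_mx v w); rewrite /= row_mxKl row_mxKr vm wn.
have mulE i n (v : 'M[A]_(n, rank i.+1)) : v *m diff i =
    row_mx (lsubmx v *m fr_diff F i) (rsubmx v *m fr_diff G i).
  by rewrite -[v in LHS]hsubmxK mul_row_block !mulmx0 addr0 add0r.
have imE i (v : 'rV[A]_(rank i)) : (exists w, v = w *m diff i) <->
    (exists w, lsubmx v = w *m fr_diff F i) /\ (exists w, rsubmx v = w *m fr_diff G i).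
  split=> [[w ->]|[[w1 e1] [w2 e2]]].
    by rewrite mulE row_mxKl row_mxKr; split; [exists (lsubmx w)|exists (rsubmx w)].
  by exists (row_mx w1 w2); rewrite mulE row_mxKl row_mxKr -e1 -e2 hsubmxK.
have ex0 v : mk_linear aug_linear v = 0 <-> exists w, v = w *m diff 0.
  by rewrite imE -!fr_exact0 /=; split=> [[-> ->]|[-> ->]].
have ex i (v : 'rV_(rank i.+1)) : v *m diff i = 0 <-> exists w, v = w *m diff i.+1.
  rewrite imE -!fr_exact mulE -[0 in X in X <-> _]row_mx0.
  by split=> [/eq_row_mx|[-> ->]].
have rE i : \rank (diff i)^res = (\rank (fr_diff F i)^res + \rank (fr_diff G i)^res)%N.
  by rewrite map_block_mx !map_mx0 rank_diag_block_mx.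
(* Subtraction in [nat] is truncated: the dimensions of homology add up because the rank of the
   boundaries never exceeds that of the cycles. *)
have subDD a b c d : (c <= a -> d <= b -> a + b - (c + d) = (a - c) + (b - d))%N by lia.
exists (FreeResolution surj ex0 ex) => -[|i]; rewrite /tor_dim /= rE.
  by apply: subDD; exact: rank_leq_col.
rewrite !mxrank_ker rE subDD ?rank_leq_row //.
by apply: subDD; rewrite leq_subRL ?rank_leq_row // addnC; exact: rank_diffs_le.
Qed.

Lemma poincare_sum :
  poincare res (M * N)%type = poincare res M + poincare res N.
Proof.
have [H HE] := sum_resolution.
apply/funext => i; rewrite [RHS](_ : _ = poincare res M i + poincare res N i) //.
by rewrite /poincare (betti_tor_dim H) (betti_tor_dim F) (betti_tor_dim G) HE.
Qed.

End DirectSum.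

End Tor.

(** * Noetherian modules and minimal resolutions *)

Section Noetherian.
Variable A : comNzRingType.
Implicit Types M N : lmodType A.

Definition submodule M (P : M -> Prop) : Prop :=
  P 0 /\ forall a u v, P u -> P v -> P (a *: u + v).

Definition finitely_generated M (P : M -> Prop) : Prop :=
  exists n (f : {linear 'rV[A]_n -> M}), forall x, P x <-> exists v, f v = x.

Definition noetherian_module M : Prop :=
  forall P : M -> Prop, submodule P -> finitely_generated P.

Lemma linear_of_family M n (x : 'I_n -> M) :
  exists f : {linear 'rV[A]_n -> M}, forall j, f (delta_mx 0 j) = x j.
Proof.
have fL : linear (fun v : 'rV[A]_n => \sum_j v 0 j *: x j).
  move=> a u v; rewrite scaler_sumr -big_split; apply: eq_bigr => j _.
  by rewrite !mxE scalerDl scalerA.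
exists (mk_linear fL) => j; rewrite /= (bigD1 j) //= big1 => [|i ij].
  by rewrite !mxE !eqxx scale1r addr0.
by rewrite !mxE (negPf ij) andbF scale0r.
Qed.

Lemma linear_on_basis M N n (f : {linear 'rV[A]_n -> M}) (g : {linear M -> N})
    (h : {linear 'rV[A]_n -> N}) :
  (forall j, g (f (delta_mx 0 j)) = h (delta_mx 0 j)) -> forall v, g (f v) = h v.
Proof.
move=> fh v; rewrite [v]row_sum_delta !linear_sum; apply: eq_bigr => j _.
by rewrite !linearZ fh.
Qed.

Lemma submodule_fam M (P : M -> Prop) n (f : {linear 'rV[A]_n -> M}) :
  submodule P -> (forall j, P (f (delta_mx 0 j))) -> forall v, P (f v).
Proof.
move=> [P0 PD] Pf v; rewrite [v]row_sum_delta linear_sum.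
by elim/big_rec: _ => // j y _ Py; rewrite linearZ; apply: PD.
Qed.

(** Lifts to [P] of generators of its image in [Q], together with generators of its preimage in [N],
    generate [P]. *)
Lemma noetherian_extension (M N Q : lmodType A) (i : {linear N -> M})
    (p : {linear M -> Q}) :
  (forall x, p x = 0 -> exists y, i y = x) ->
  noetherian_module N -> noetherian_module Q -> noetherian_module M.
Proof.
move=> ex noN noQ P subP; have [P0 PD] := subP.
have [|n [f fE]] := noN (fun y => P (i y)).
  by split=> [|a u v Pu Pv]; rewrite ?linear0 // linearP; exact: PD.
have [|m [g gE]] := noQ (fun z => exists2 x, P x & p x = z).
  split=> [|a _ _ [u Pu <-] [v Pv <-]]; first by exists 0; rewrite ?linear0.
  by exists (a *: u + v); [exact: PD|rewrite linearP].
have /choice[x xE] : forall j, exists x, P x /\ p x = g (delta_mx 0 j).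
  by move=> j; have [|x] := (gE (g (delta_mx 0 j))).2; [exists (delta_mx 0 j)|exists x].
have [l lE] := linear_of_family x.
have hL : linear (fun v : 'rV[A]_(m + n) => l (lsubmx v) + i (f (rsubmx v))).
  by move=> a u v; rewrite !linearP /= scalerDr addrACA.
have Pl v : P (l v).
  by apply: submodule_fam => // j; rewrite lE; exact: (xE j).1.
have pl v : p (l v) = g v.
  by apply: (linear_on_basis (g := p)) => j; rewrite lE; exact: (xE j).2.
exists (m + n)%N, (mk_linear hL) => y; split=> [Py|[v <-]] /=; last first.
  rewrite -[l _]scale1r; apply: PD; first exact: Pl.
  by apply/fE; exists (rsubmx v).
have [|v vE] := (gE (p y)).1; first by exists y.
have [|z zE] := ex (y - l v); first by rewrite linearB /= pl vE subrr.
have [|w wE] := (fE z).1.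
  by rewrite zE addrC -scaleN1r; apply: PD => //; exact: Pl.
by exists (row_mx v w); rewrite /= row_mxKl row_mxKr wE zE addrC subrK.
Qed.

Lemma noetherian_submodule M N (i : {linear N -> M}) :
  injective i -> noetherian_module M -> noetherian_module N.
Proof.
move=> inj_i noM P [P0 PD].
have [|n [f fE]] := noM (fun x => exists2 y, P y & i y = x).
  split=> [|a _ _ [u Pu <-] [v Pv <-]]; first by exists 0; rewrite ?linear0.
  by exists (a *: u + v); [exact: PD|rewrite linearP].
have /choice[x xE] : forall j, exists x, P x /\ i x = f (delta_mx 0 j).
  by move=> j; have [|x] := (fE (f (delta_mx 0 j))).2; [exists (delta_mx 0 j)|exists x].
have [l lE] := linear_of_family x.
have il v : i (l v) = f v.
  by apply: (linear_on_basis (g := i)) => j; rewrite lE; exact: (xE j).2.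
exists n, l => y; split=> [Py|[v <-]].
  have [|v vE] := (fE (i y)).1; first by exists y.
  by exists v; apply: inj_i; rewrite il.
by apply: submodule_fam => // j; rewrite lE; exact: (xE j).1.
Qed.

Definition noetherian_ring : Prop := noetherian_module A^o.

Lemma noetherian_row n : noetherian_ring -> noetherian_module 'rV[A]_n.
Proof.
move=> noA; elim: n => [|n IH].
  move=> P [P0 _]; exists 0%N, idfun => x; split=> [_|_]; first by exists x.
  by rewrite (thinmx0 x).
have iL : linear (fun a : A^o => row_mx a%:M 0 : 'rV[A]_(1 + n)).
  move=> a u v; rewrite scale_row_mx add_row_mx scaler0 addr0.
  congr (row_mx _ _); apply/matrixP => i j; by rewrite !ord1 !mxE eqxx !mulr1n.
apply: (@noetherian_extension 'rV[A]_(1 + n) A^o 'rV[A]_n (mk_linear iL) rsubmx) => //.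
move=> x x0; exists (lsubmx x 0 0).
by rewrite /= -[RHS]hsubmxK [rsubmx x]x0 -mx11_scalar.
Qed.

End Noetherian.

Lemma restrict_finitely_generated (A B : comNzRingType) (h : {rmorphism A -> B})
    (M : lmodType B) (P : M -> Prop) :
  onto h -> finitely_generated P -> finitely_generated (P : restrict_scalars h M -> Prop).
Proof.
move=> honto [n [f fE]].
have gL : linear (fun v : 'rV[A]_n => f (map_mx h v) : restrict_scalars h M).
  by move=> a u v; rewrite map_mxD map_mxZ linearP.
exists n, (mk_linear gL) => x; rewrite fE; split=> [[v <-]|[v <-]] /=.
  have /choice[w wE] : forall j, exists a, h a = v 0 j by move=> j; exact: honto.
  exists (\row_j w j); congr (f _); apply/rowP => j; by rewrite !mxE wE.
by exists (map_mx h v).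
Qed.

Lemma noetherian_restrict (A B : comNzRingType) (h : {rmorphism A -> B})
    (M : lmodType B) :
  onto h -> noetherian_module M -> noetherian_module (restrict_scalars h M).
Proof.
move=> honto noM P [P0 PD]; apply: restrict_finitely_generated => //.
apply: noM; split=> // b u v; have [a <-] := honto b; exact: PD.
Qed.

(** * Minimal resolutions over a Noetherian local ring *)

Section MinimalResolution.
Variables (k : fieldType) (A : comNzRingType) (res : {rmorphism A -> k}).
Hypothesis A_noeth : noetherian_ring A.
Hypothesis A_local : forall a, res a != 0 -> exists b, b * a = 1.

(** A generating family of least size has no relation with a unit coefficient, since such a relation
    would eliminate a generator. This takes the place of Nakayama's lemma. *)
Lemma minimal_generators (M : lmodType A) (P : M -> Prop) :
  finitely_generated P -> exists n (f : {linear 'rV[A]_n -> M}),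
    (forall x, P x <-> exists v, f v = x) /\
    (forall v, f v = 0 -> map_mx res v = 0).
Proof.
move=> fgP; pose G n := `[< exists f : {linear 'rV[A]_n -> M},
  forall x, P x <-> exists v, f v = x >].
have exG : exists n, G n by have [n [f fE]] := fgP; exists n; apply/asboolP; exists f.
case: (ex_minnP exG) => n /asboolP[f fE] minn; exists n, f; split=> // v fv0.
apply: contrapT => /eqP v0.
have [j vj] : exists j, res (v 0 j) != 0.
  apply: contrapT => nv; case/eqP: v0; apply/rowP => j; rewrite !mxE.
  by apply: contrapT => /eqP vj; apply: nv; exists j.
have [b bv] := A_local vj.
case: n => [|n] in f fE minn v fv0 v0 j vj bv *; first by case: j {vj bv}.
suff /minn : G n by rewrite ltnn.
(* [L] inserts a zero at position [j], so [f (u *m L)] avoids the [j]-th generator. *)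
pose L : 'M[A]_(n, n.+1) := row' j 1%:M.
have gL : linear (fun u : 'rV[A]_n => f (u *m L)).
  by move=> a u w; rewrite mulmxDl -scalemxAl linearP.
apply/asboolP; exists (mk_linear gL) => x; rewrite fE; split=> [[w <-]|[w <-]] /=; last first.
  by exists (w *m L).
(* Subtracting a multiple of the relation [v] keeps the image under [f] and clears the [j]-th
   coordinate. *)
pose w' := w - (w 0 j * b) *: v.
exists (col' j w'); rewrite (_ : _ *m L = w').
  by rewrite /w' linearB linearZ /= fv0 scaler0 subr0.
apply/rowP => l; rewrite !mxE.
case: (unliftP j l) => [i|] ->.
  rewrite (bigD1 i) //= big1 => [|i' ii'].
    by rewrite !mxE eqxx mulr1 addr0.
  by rewrite !mxE (inj_eq (lift_inj (h:=j))) (negPf ii') mulr0.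
rewrite -mulrA bv mulr1 subrr big1 // => i _.
by rewrite !mxE eq_sym (negPf (neq_lift _ _)) mulr0.
Qed.

Lemma minimal_syzygy a b (D : 'M[A]_(a, b)) : exists n (E : 'M[A]_(n, a)),
  (forall v : 'rV_a, v *m D = 0 <-> exists w, v = w *m E) /\
  (forall w : 'rV_n, w *m E = 0 -> map_mx res w = 0).
Proof.
have [n [f [fE fmin]]] : exists n (f : {linear 'rV[A]_n -> 'rV[A]_a}),
    (forall v, v *m D = 0 <-> exists w, f w = v) /\
    (forall w, f w = 0 -> map_mx res w = 0).
  apply: minimal_generators; apply: noetherian_row => //.
  split=> [|c u v u0 v0]; first by rewrite mul0mx.
  by rewrite mulmxDl -scalemxAl u0 v0 scaler0 addr0.
exists n, (lin1_mx f); split=> [v|w]; last by rewrite mul_rV_lin1; exact: fmin.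
rewrite fE; split=> -[w wE]; exists w; rewrite ?mul_rV_lin1 ?wE //.
by rewrite mul_rV_lin1.
Qed.

Definition minimal_resolution M (F : free_resolution M) :=
  forall i, map_mx res (fr_diff F i) = 0.

Lemma minimal_resolution_exists (M : lmodType A) :
  finitely_generated (fun _ : M => True) ->
  exists F : free_resolution M, minimal_resolution F.
Proof.
move=> /minimal_generators[n0 [f [fE fmin]]].
have syzE a b (D : 'M[A]_(a, b)) : {nE : {n : nat & 'M[A]_(n, a)} |
    (forall v : 'rV_a, v *m D = 0 <-> exists w, v = w *m projT2 nE) /\
    (forall w : 'rV_(projT1 nE), w *m projT2 nE = 0 -> map_mx res w = 0)}.
  apply: cid; have [n [E EP]] := minimal_syzygy D.
  by exists (existT (fun n => 'M[A]_(n, a)) n E); exact: EP.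
pose syz a b D := sval (syzE a b D).
have syzP a b (D : 'M[A]_(a, b)) :
    (forall v : 'rV_a, v *m D = 0 <-> exists w, v = w *m projT2 (syz _ _ D)) /\
    (forall w : 'rV_(projT1 (syz _ _ D)), w *m projT2 (syz _ _ D) = 0 ->
      map_mx res w = 0) := svalP (syzE a b D).
have [n1 [D0 [D0E D0min]]] : exists n1 (D0 : 'M[A]_(n1, n0)),
    (forall v, f v = 0 <-> exists w, v = w *m D0) /\
    (forall w : 'rV_n1, w *m D0 = 0 -> map_mx res w = 0).
  have [n1 [g [gE gmin]]] : exists n (g : {linear 'rV[A]_n -> 'rV[A]_n0}),
      (forall v, f v = 0 <-> exists w, g w = v) /\
      (forall w, g w = 0 -> map_mx res w = 0).
    apply: (minimal_generators (P := fun v => f v = 0)); apply: noetherian_row => //.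
    split=> [|c u v u0 v0]; first by rewrite linear0.
    by rewrite linearP /= u0 v0 scaler0 addr0.
  exists n1, (lin1_mx g); split=> [v|w]; last by rewrite mul_rV_lin1; exact: gmin.
  rewrite gE; split=> -[w wE]; exists w; first by rewrite -wE mul_rV_lin1.
  by rewrite wE mul_rV_lin1.
(* A stage carries its matrix together with both sizes, because each rank is known only once the
   syzygies have been chosen. *)
pose T := {a : nat & {b : nat & 'M[A]_(a, b)}}.
pose mkT a b D : T := existT (fun a => {b : nat & 'M[A]_(a, b)}) a
  (existT (fun b => 'M[A]_(a, b)) b D).
pose next (D : T) := mkT _ _ (projT2 (syz _ _ (projT2 (projT2 D)))).
pose diffs i := iter i next (mkT _ _ D0).
pose rank i := projT1 (projT2 (diffs i)).
pose diff i : 'M[A]_(rank i.+1, rank i) :=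
  match i with 0 => D0 | j.+1 => projT2 (projT2 (diffs j.+1)) end.
have surj m : exists v, f v = m by exact/fE.
have ex i (v : 'rV_(rank i.+1)) : v *m diff i = 0 <-> exists w, v = w *m diff i.+1.
  by case: i v => [|i] v; exact: (syzP _ _ _).1.
exists (@FreeResolution A M rank diff f surj D0E ex) => i.
have minD (w : 'rV_(rank i.+1)) : w *m diff i = 0 -> map_mx res w = 0.
  by case: i w => [|i] w; [exact: D0min|exact: (syzP _ _ _).2].
(* Each row of a differential is a relation between the minimal generators one step earlier, so its
   entries have residue 0. *)
apply/row_matrixP => j; rewrite row0 -map_row.
case: i minD j => [|i] minD j.
  apply: fmin; apply/D0E; exists (delta_mx 0 j); by rewrite -rowE.
have minD' (w : 'rV_(rank i.+1)) : w *m diff i = 0 -> map_mx res w = 0.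
  by case: i w {minD j} => [|i] w; [exact: D0min|exact: (syzP _ _ _).2].
apply: minD'; apply/ex; exists (delta_mx 0 j); by rewrite -rowE.
Qed.

Lemma tor_dim_minimal (M : lmodType A) (F : free_resolution M) i :
  minimal_resolution F -> tor_dim res F i = fr_rank F i.
Proof.
by move=> minF; rewrite tor_dimE minF mxrank0 subn0; case: i => [|i] /=;
  rewrite ?mxrank1 // minF mxrank_ker mxrank0 subn0.
Qed.

End MinimalResolution.

(** * Algebra retracts *)

Section Retract.
Variables (k : fieldType) (A B : comNzRingType).
Variables (p : {rmorphism A -> B}) (s : {rmorphism B -> A}).
Hypothesis sK : cancel s p.
Variables (resA : {rmorphism A -> k}) (resB : {rmorphism B -> k}).
Hypothesis res_p : forall a, resB (p a) = resA a.
Variables (M : lmodType B) (G : free_resolution M).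
Variable F : free_resolution (restrict_scalars p B^o).

Local Notation g := (fr_rank G).
Local Notation f := (fr_rank F).
Let D i : 'M[A]_(g i.+1, g i) := map_mx s (fr_diff G i).
Let E j : 'M[A]_(f j.+1, f j) := fr_diff F j.

(* An element of the product over all (i, j) of G_i (x) F_j.  Keeping both
   indices, instead of the total degree, avoids casts along i + j = n. *)
Definition bifamily := forall i j, 'M[A]_(g i, f j).
Implicit Types C : bifamily.

(** An element of the tensor product of two free modules is a matrix: the differential of [G], moved
    to [A] by [s], acts on the left and that of [F] on the right. The sign makes the square
    vanish. *)
Definition tot_diff C : bifamily := fun i j =>
  (D i)^T *m C i.+1 j + (-1) ^+ i *: (C i j.+1 *m E j).

Lemma map_D i : map_mx p (D i) = fr_diff G i.
Proof. by apply/matrixP => a b; rewrite !mxE sK. Qed.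

Lemma D_mul i : D i.+1 *m D i = 0.
Proof. by rewrite -map_mxM fr_diff_mul map_mx0. Qed.

Lemma tot_diff_diff C i j : tot_diff (tot_diff C) i j = 0.
Proof.
rewrite /tot_diff mulmxDr mulmxDl scalerDr !mulmxA -trmx_mul D_mul trmx0 mul0mx add0r.
rewrite -!scalemxAl -scalemxAr -[_ *m E j.+1 *m E j]mulmxA fr_diff_mul mulmx0 !scaler0 addr0.
by rewrite exprS mulN1r scaleNr mulmxA addNr.
Qed.

(* The map G_i (x) F_0 -> G_i (x)_A B induced by the augmentation of F. *)
Definition row_aug n (X : 'M[A]_(n, f 0)) : 'rV[B]_n := \row_i (fr_aug F (row i X) : B).

Lemma row_aug_linear n a (X Y : 'M[A]_(n, f 0)) :
  row_aug (a *: X + Y) = p a *: row_aug X + row_aug Y.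
Proof. by apply/rowP => i; rewrite !mxE !linearP. Qed.

Lemma row_aug0 n : row_aug (0 : 'M[A]_(n, f 0)) = 0.
Proof. by apply/rowP => i; rewrite !mxE row0 linear0. Qed.

Lemma row_augN n (X : 'M[A]_(n, f 0)) : row_aug (- X) = - row_aug X.
Proof. by rewrite -scaleN1r -[_ *: X]addr0 row_aug_linear row_aug0 addr0 rmorphN1 scaleN1r. Qed.

Lemma row_augD n (X Y : 'M[A]_(n, f 0)) : row_aug (X + Y) = row_aug X + row_aug Y.
Proof. by rewrite -[X in X + Y]scale1r row_aug_linear rmorph1 scale1r. Qed.

Lemma row_augM m n (U : 'M[A]_(m, n)) (X : 'M[A]_(n, f 0)) :
  row_aug (U *m X) = row_aug X *m (map_mx p U)^T.
Proof.
apply/rowP => i; rewrite !mxE row_mul mulmx_sum_row linear_sum.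
by apply: eq_bigr => j _; rewrite linearZ !mxE mulrC.
Qed.

Lemma row_aug_diff n (X : 'M[A]_(n, f 1)) : row_aug (X *m E 0) = 0.
Proof. by apply/rowP => i; rewrite !mxE row_mul fr_aug_diff. Qed.

Lemma row_aug_exact n (X : 'M[A]_(n, f 0)) :
  row_aug X = 0 -> exists Y, X = Y *m E 0.
Proof.
move=> X0; apply: fr_exact0_mx => v; rewrite mulmx_sum_row linear_sum big1 // => i _.
rewrite linearZ; have /rowP/(_ i) := X0; rewrite !mxE => ->.
by rewrite /= scaler0.
Qed.

Lemma row_aug_surj n (u : 'rV[B]_n) : exists X, row_aug X = u.
Proof.
have /choice[w wE] : forall i, exists v, fr_aug F v = u 0 i :> B.
  by move=> i; have [v vE] := fr_aug_surj F (u 0 i); exists v.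
by exists (\matrix_i w i); apply/rowP => i; rewrite !mxE rowK wE.
Qed.

(** [C'] is built by increasing [j]. The column 0 comes from exactness of [G], each later one from
    exactness of [F]; the invariant [P] says that the defect left by a column is a cycle for [F]. *)
Lemma tot_exact C : (forall i j, tot_diff C i j = 0) ->
  fr_aug G (row_aug (C 0%N 0%N)) = 0 ->
  exists C', forall i j, tot_diff C' i j = C i j.
Proof.
move=> dC augC; pose T j := forall i, 'M[A]_(g i, f j).
pose cyc j : forall i, 'M[A]_(g i, f j) -> Prop := match j with
  | 0 => fun i Y => row_aug Y = 0
  | j'.+1 => fun i Y => Y *m E j' = 0 end.
pose P j (X : T j) := forall i, cyc j i (C i j - (D i)^T *m X i.+1).
pose Q j (X : T j) (X' : T j.+1) := forall i,
  C i j - (D i)^T *m X i.+1 = (-1) ^+ i *: (X' i *m E j).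
have [||C' [_ C'Q]] := @dependent_choice_seq T P Q.
(* [row_aug] kills the term through [E 0], so the images of the [C i 0] are cycles of [G]; for
   [i = 0] the hypothesis on the augmentation takes the place of the differential. *)
- have w i : exists w, row_aug (C i 0%N) = w *m fr_diff G i.
    case: i => [|i]; first exact/fr_exact0.
    apply/fr_exact; have := congr1 (@row_aug _) (dC i 0%N).
    rewrite row_augD row_aug0 -[X in row_aug (X *: _)]mulr1 -scalerA.
    rewrite row_augM -map_trmx trmxK map_D => /eqP.
    rewrite -[_ *: (1 *: _)]addr0 row_aug_linear scale1r row_aug_diff row_aug0.
    by rewrite scaler0 !addr0 => /eqP.
  have X i : {X : 'M[A]_(g i.+1, f 0) | row_aug (C i 0%N) = row_aug X *m fr_diff G i}.
    apply: cid; have [u uE] := w i; have [X XE] := row_aug_surj u.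
    by exists X; rewrite XE.
  exists (fun i => match i with 0 => 0 | i'.+1 => sval (X i') end) => i /=.
  rewrite row_augD row_augN row_augM -map_trmx trmxK map_D.
  by apply/eqP; rewrite subr_eq0; apply/eqP; exact: svalP (X i).
- move=> j X PX.
  have X' i : {X' | C i j - (D i)^T *m X i.+1 = (-1) ^+ i *: (X' *m E j)}.
    apply: cid; have [Y YE] : exists Y, C i j - (D i)^T *m X i.+1 = Y *m E j.
      by case: j X PX => [|j] X PX; [apply: row_aug_exact|apply: fr_exact_mx]; exact: PX.
    by exists ((-1) ^+ i *: Y); rewrite -scalemxAl scalerA -expr2 sqrr_sign scale1r.
  exists (fun i => sval (X' i)); split=> i; first exact: svalP (X' i).
  (* Once the choice of [X'] is substituted, the term with two factors [D] vanishes and the rest is,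
     up to sign, [tot_diff C i j]. *)
  rewrite /= mulmxBl -mulmxA.
  have -> : sval (X' i.+1) *m E j = (-1) ^+ i.+1 *: (C i.+1 j - (D i.+1)^T *m X i.+2).
    by rewrite [RHS](congr1 _ (svalP (X' i.+1))) scalerA -expr2 sqrr_sign scale1r.
  rewrite -scalemxAr mulmxBr mulmxA -trmx_mul D_mul trmx0 mul0mx subr0.
  rewrite exprS mulN1r scaleNr opprK addrC.
  have /(congr1 (fun Y => (-1) ^+ i *: Y)) := dC i j.
  by rewrite /tot_diff scaler0 scalerDr scalerA -expr2 sqrr_sign scale1r.
- exists (fun i j => C' j i) => i j; rewrite /tot_diff -C'Q.
  by rewrite addrC subrK.
Qed.

Definition tot_index n : finType := {i : 'I_n.+1 & ('I_(g i) * 'I_(f (n - i)))%type}.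
Definition tot_rank n := #|tot_index n|.

Definition tot_coord n C : 'rV[A]_(tot_rank n) := \row_(x < #|tot_index n|)
  (let t : tot_index n := enum_val x in C (tag t) (n - tag t)%N (tagged t).1 (tagged t).2).

(** Positions are compared as natural numbers, which avoids a cast between [f (n - tag t)] and
    [f j]. *)
Definition at_pos n i j (a : 'I_(g i)) (b : 'I_(f j)) : pred (tot_index n) := fun t =>
  [&& tag t == i :> nat, n - tag t == j, (tagged t).1 == a :> nat & (tagged t).2 == b :> nat]%N.

(** At most one index contributes to each sum; off the diagonal [i + j = n] there is none and the
    matrix is 0. *)
Definition tot_family n (v : 'rV[A]_(tot_rank n)) : bifamily := fun i j =>
  \matrix_(a, b) \sum_(t | at_pos a b t) v 0 (enum_rank t).

Lemma tot_familyP n c (u v : 'rV[A]_(tot_rank n)) i j :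
  tot_family (c *: u + v) i j = c *: tot_family u i j + tot_family v i j.
Proof.
apply/matrixP => a b; rewrite !mxE mulr_sumr -big_split.
by apply: eq_bigr => t _; rewrite !mxE.
Qed.

Lemma tot_family0 n i j : tot_family (0 : 'rV[A]_(tot_rank n)) i j = 0.
Proof. by apply/matrixP => a b; rewrite !mxE big1 // => t _; rewrite mxE. Qed.

Lemma tot_familyK n (v : 'rV[A]_(tot_rank n)) : tot_coord n (tot_family v) = v.
Proof.
apply/rowP => x; rewrite mxE /= mxE (big_pred1 (enum_val x)) ?enum_valK // => t /=.
apply/idP/eqP => [|->]; last by rewrite /at_pos !eqxx.
case: (enum_val x) t => [i [a b]] [i' [a' b']] /and4P[/= /eqP ii _ /eqP aa /eqP bb].
have {}ii : i' = i by exact: val_inj.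
by subst i'; rewrite (val_inj aa) (val_inj bb).
Qed.

Lemma tot_coordK n C i j :
  tot_family (tot_coord n C) i j = if (i + j == n)%N then C i j else 0.
Proof.
apply/matrixP => a b; rewrite mxE.
case: eqP => [ijn|ijn]; last first.
  rewrite big1 ?mxE // => t /and4P[/eqP ti /eqP tj _ _]; case: ijn.
  by rewrite -tj -ti subnKC // -ltnS.
have jE : j = (n - i)%N by lia.
have ltin : (i < n.+1)%N by lia.
subst j; pose t : tot_index n := existT _ (Ordinal ltin) (a, b).
rewrite (big_pred1 t) ?mxE ?enum_rankK // => t' /=.
apply/idP/eqP => [|->]; last by rewrite /at_pos /= !eqxx.
case: t' => [[i' lti'] [a' b']] /and4P[/= /eqP ii _ /eqP aa /eqP bb].
subst i'; have ea : a' = a by exact: val_inj.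
have eb : b' = b by exact: val_inj.
by rewrite ea eb /t (bool_irrelevance ltin lti').
Qed.

Lemma card_tot_index n : #|tot_index n| = (\sum_(i < n.+1) g i * f (n - i))%N.
Proof.
rewrite card_tagged sumnE big_map big_enum.
by apply: eq_bigr => i _; rewrite card_prod !card_ord.
Qed.

Let tot_mx_linear n : linear (fun v : 'rV[A]_(tot_rank n.+1) =>
  tot_coord n (tot_diff (tot_family v)) : 'rV[A]_(tot_rank n)).
Proof.
move=> c u v; apply/rowP => x; rewrite !mxE /= /tot_diff !tot_familyP.
rewrite mulmxDr mulmxDl -!scalemxAr -!scalemxAl scalerDr !mxE.
by rewrite mulrDr -!addrA; congr (_ + _); rewrite addrCA mulrCA.
Qed.

Definition tot_mx n : 'M[A]_(tot_rank n.+1, tot_rank n) := lin1_mx (mk_linear (@tot_mx_linear n)).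

Lemma tot_mxE n (v : 'rV_(tot_rank n.+1)) :
  v *m tot_mx n = tot_coord n (tot_diff (tot_family v)).
Proof. by rewrite mul_rV_lin1. Qed.

Lemma tot_family_supp n (v : 'rV_(tot_rank n)) i j :
  (i + j != n)%N -> tot_family v i j = 0.
Proof. by move=> ij; rewrite -[v]tot_familyK tot_coordK (negPf ij). Qed.

Lemma tot_family_mx n (v : 'rV_(tot_rank n.+1)) i j :
  tot_family (v *m tot_mx n) i j = tot_diff (tot_family v) i j.
Proof.
rewrite tot_mxE tot_coordK; case: eqP => // /eqP ijn.
by rewrite /tot_diff !tot_family_supp ?mulmx0 ?mul0mx ?scaler0 ?addr0 //; lia.
Qed.

Lemma tot_family_inj n (u v : 'rV_(tot_rank n)) :
  (forall i j, tot_family u i j = tot_family v i j) -> u = v.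
Proof.
move=> uv; rewrite -[u]tot_familyK -[v]tot_familyK.
by apply/rowP => x; rewrite !mxE /= uv.
Qed.

(** The preimage given by [tot_exact] can be cut down to total degree [n.+1], since [tot_diff]
    lowers the total degree by one. *)
Lemma tot_exact_mx n (v : 'rV_(tot_rank n)) :
  (forall i j, tot_diff (tot_family v) i j = 0) ->
  fr_aug G (row_aug (tot_family v 0 0)) = 0 ->
  exists w, v = w *m tot_mx n.
Proof.
move=> dv /(tot_exact dv)[C CE]; exists (tot_coord n.+1 C).
apply: tot_family_inj => i j; rewrite tot_family_mx /tot_diff !tot_coordK.
have [ijn|ijn] := eqVneq (i + j)%N n.
  by rewrite !ifT -?CE //; lia.
by rewrite !ifF ?tot_family_supp ?mulmx0 ?mul0mx ?scaler0 ?addr0 //; lia.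
Qed.

(** The section respects residues: [resA (s b) = resB (p (s b)) = resB b]. Hence [D] inherits the
    minimality of [G]. *)
Lemma tot_diff_res C i j : minimal_resolution resB G -> minimal_resolution resA F ->
  map_mx resA (tot_diff C i j) = 0.
Proof.
move=> minG minF; rewrite /tot_diff map_mxD map_mxZ !map_mxM minF mulmx0 scaler0 addr0.
rewrite -map_trmx (_ : map_mx resA (D i) = 0) ?trmx0 ?mul0mx // -(minG i).
by apply/matrixP => a b; rewrite !mxE -res_p sK.
Qed.

Let tot_aug_linear : linear (fun v : 'rV[A]_(tot_rank 0) =>
  fr_aug G (row_aug (tot_family v 0 0)) : restrict_scalars p M).
Proof. by move=> c u v; rewrite tot_familyP row_aug_linear linearP. Qed.

Lemma tot_resolution : exists H : free_resolution (restrict_scalars p M),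
  (forall n, fr_rank H n = \sum_(i < n.+1) g i * f (n - i))%N /\
  (minimal_resolution resB G -> minimal_resolution resA F -> minimal_resolution resA H).
Proof.
have surj m : exists v, mk_linear tot_aug_linear v = m.
  have [u uE] := fr_aug_surj G m; have [X XE] := row_aug_surj u.
  pose C : bifamily := fun i j => match i, j return 'M[A]_(g i, f j) with
    | 0, 0 => X | _, _ => 0 end.
  by exists (tot_coord 0 C); rewrite /= tot_coordK /= XE.
have ex0 v : mk_linear tot_aug_linear v = 0 <-> exists w, v = w *m tot_mx 0.
  split=> [v0|[w ->]] /=.
    apply: tot_exact_mx v0 => i j.
    by rewrite /tot_diff !tot_family_supp ?mulmx0 ?mul0mx ?scaler0 ?addr0 //; lia.
  rewrite tot_family_mx /tot_diff expr0 scale1r row_augD row_augM row_aug_diff addr0.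
  by rewrite -map_trmx trmxK map_D fr_aug_diff.
have ex n (v : 'rV_(tot_rank n.+1)) : v *m tot_mx n = 0 <-> exists w, v = w *m tot_mx n.+1.
  split=> [v0|[w ->]].
    apply: tot_exact_mx => [i j|]; first by rewrite -tot_family_mx v0 tot_family0.
    by rewrite tot_family_supp ?row_aug0 ?linear0.
  apply: tot_family_inj => i j; rewrite tot_family_mx tot_family0.
  by rewrite /tot_diff !tot_family_mx; exact: tot_diff_diff.
exists (FreeResolution surj ex0 ex); split=> [n|minG minF n] /=; first exact: card_tot_index.
have resE C i j a b : resA (tot_diff C i j a b) = 0.
  by have /matrixP/(_ a b) := tot_diff_res C i j minG minF; rewrite !mxE.
apply/row_matrixP => x; rewrite row0 -map_row rowE tot_mxE.
by apply/rowP => y; rewrite [LHS]mxE [in LHS]mxE [RHS]mxE; exact: resE.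
Qed.

End Retract.

Lemma poincare_retract (k : fieldType) (A B : comNzRingType)
    (p : {rmorphism A -> B}) (s : {rmorphism B -> A})
    (resA : {rmorphism A -> k}) (resB : {rmorphism B -> k}) (M : lmodType B)
    (G : free_resolution M) (F : free_resolution (restrict_scalars p B^o)) :
  cancel s p -> (forall a, resB (p a) = resA a) ->
  minimal_resolution resB G -> minimal_resolution resA F ->
  poincare resA (restrict_scalars p M) = poincare resB M * poincare_hom resA p.
Proof.
move=> sK res_p minG minF.
have [H [rankH minH]] := tot_resolution sK res_p G F.
apply/funext => n.
rewrite [RHS](_ : _ = \sum_(i < n.+1) poincare resB M i * poincare_hom resA p (n - i)%N) //.
rewrite /poincare_hom /poincare (betti_tor_dim resA H) tor_dim_minimal ?rankH; last exact: minH.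
rewrite (big_morph Posz PoszD (erefl (Posz 0))); apply: eq_bigr => i _.
by rewrite (betti_tor_dim _ G) (betti_tor_dim _ F) !tor_dim_minimal // PoszM.
Qed.

(** * Fiber products *)

Lemma fps_coefM (K : comNzRingType) (f g : fps K) n :
  (f * g) n = \sum_(i < n.+1) f i * g (n - i)%N.
Proof. by []. Qed.

Lemma fps_X_pow_coef (h : fps int) i n : (n < i)%N -> ((fps_X * h) ^+ i) n = 0.
Proof.
elim: i n => // i IH n ni; rewrite exprS -mulrA fps_X_mulE.
case: n ni => // n ni; rewrite fps_coefM big1 // => j _.
by rewrite IH ?mulr0 //; lia.
Qed.

(** The inverse is the geometric series in [fps_X * h], of which only the powers up to [n] reach the
    [n]-th coefficient. *)
Lemma fps_unit_subX (h : fps int) : 1 - fps_X * h \is a GRing.unit.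
Proof.
pose y := fps_X * h; pose g : fps int := fun n => (\sum_(i < n.+1) y ^+ i) n.
have sumE n m : (n <= m)%N -> g n = (\sum_(i < m.+1) y ^+ i) n.
  move=> nm; rewrite -(subnKC nm); elim: (m - n)%N => [|d ->]; first by rewrite addn0.
  rewrite addnS [in RHS]big_ord_recr.
  rewrite [RHS](_ : _ = (\sum_(i < (n + d).+1) y ^+ i) n + (y ^+ (n + d).+1) n) //.
  by rewrite fps_X_pow_coef ?addr0 // ltnS leq_addr.
apply/asboolP; exists g; apply/funext => n.
transitivity (((\sum_(i < n.+1) y ^+ i) * (1 - y)) n).
  by rewrite !fps_coefM; apply: eq_bigr => i _; rewrite (sumE _ n) // -ltnS.
rewrite mulrC -opprB mulNr -subrX1 opprB.
by rewrite [LHS](_ : _ = (1 : fps int) n - (y ^+ n.+1) n) // fps_X_pow_coef ?subr0.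
Qed.

Lemma ker_val_linear (A B : comNzRingType) (h : {rmorphism A -> B}) :
  linear (fun u : ker_module h => val u : A^o).
Proof. by []. Qed.

Lemma noetherian_ker (A B : comNzRingType) (h : {rmorphism A -> B}) :
  noetherian_ring A -> noetherian_module (ker_module h).
Proof.
by move=> noA; apply: (@noetherian_submodule A A^o (ker_module h)
  (mk_linear (@ker_val_linear A B h))).
Qed.

Lemma noetherian_fg (A : comNzRingType) (M : lmodType A) :
  noetherian_module M -> finitely_generated (fun _ : M => True).
Proof. by apply; split. Qed.

Section QuotientByKernel.
Variables (k : fieldType) (A B : comNzRingType) (resA : {rmorphism A -> k}).
Variable h : {rmorphism A -> B}.
Hypothesis h_onto : onto h.
Hypothesis ker_res : forall a, h a = 0 -> resA a = 0.

Lemma ker_moduleP (a : A) : h a = 0 <-> exists u : ker_module h, a = val u.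
Proof.
split=> [ha|[u ->]]; last by apply/eqP; exact: (valP u).
have ua : (a : A^o) \in rker h by rewrite unfold_in ha.
by exists (exist _ a ua).
Qed.

(** [M] is any model of the quotient of [A] by the kernel of [h]: both the ring [B] and quotient
    modules by ideals occur below. *)
Lemma poincare_ker_shift (M : lmodType A) (q : {linear A^o -> M})
    (F : free_resolution (ker_module h)) :
  onto q -> (forall a, q a = 0 <-> h a = 0) ->
  poincare resA M = 1 + fps_X * poincare resA (ker_module h).
Proof.
move=> q_onto qE; apply: (@poincare_shift _ _ _ M (ker_module h) q
  (mk_linear (@ker_val_linear A B h))) => //.
  by move=> a; rewrite qE ker_moduleP.
by move=> u; apply: ker_res; apply/ker_moduleP; exists u.
Qed.

Lemma poincare_hom_shift (F : free_resolution (ker_module h)) :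
  poincare_hom resA h = 1 + fps_X * poincare resA (ker_module h).
Proof.
have hL : linear (fun a : A^o => h a : restrict_scalars h B^o).
  by move=> c u v; rewrite rmorphD rmorphM.
exact: (poincare_ker_shift (q := mk_linear hL)).
Qed.

End QuotientByKernel.

Section QuotModule.
Variables (A : comNzRingType) (I : idealr A).

Let pi_linear : linear (fun a : A^o => \pi_{ideal_quot I} a : quot_module I).
Proof. by move=> c u v; rewrite rmorphD rmorphM. Qed.

Lemma quot_projection : exists q : {linear A^o -> quot_module I},
  onto q /\ forall a, q a = 0 <-> a \in I.
Proof.
exists (mk_linear pi_linear); split=> [x|a] /=.
  by exists (repr (x : {ideal_quot I})); exact: reprK.
have aE : (a \in I) = (\pi_{ideal_quot I} a == \pi_{ideal_quot I} 0).
  by rewrite -Quotient.idealrBE subr0.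
by rewrite aE rmorph0; split=> /eqP.
Qed.

End QuotModule.

Section FiberProductSeries.
Variables (k : fieldType) (A B D : comNzRingType).
Variables (f : {rmorphism A -> D}) (g : {rmorphism B -> D}).
Variables (resA : {rmorphism A -> k}) (resB : {rmorphism B -> k}).
Hypotheses (f_onto : onto f) (g_onto : onto g).
Hypothesis res_fg : forall a b, f a = g b -> resA a = resB b.
Hypotheses (A_noeth : noetherian_ring A) (B_noeth : noetherian_ring B).
Hypothesis A_local : forall a, resA a != 0 -> exists b, b * a = 1.
Hypothesis B_local : forall b, resB b != 0 -> exists c, c * b = 1.

Local Notation V := (fiber_product f g).
Local Notation p1 := (@fiber_fst _ _ _ f g).
Local Notation p2 := (@fiber_snd _ _ _ f g).
Let resV : {rmorphism V -> k} := resA \o p1.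

Definition fiber_pair a b (e : f a = g b) : V := exist _ (a, b) (introT eqP e).

Lemma fiber_eq (v : V) : f (p1 v) = g (p2 v).
Proof. exact/eqP/(valP v). Qed.

Lemma fiber_ext (u v : V) : p1 u = p1 v -> p2 u = p2 v -> u = v.
Proof.
move=> e1 e2; apply: val_inj; rewrite [LHS]surjective_pairing [RHS]surjective_pairing.
by congr (_, _).
Qed.

Lemma fiber_fst_onto : onto p1.
Proof. by move=> a; have [b /esym e] := g_onto (f a); exists (fiber_pair e). Qed.

Lemma fiber_snd_onto : onto p2.
Proof. by move=> b; have [a e] := f_onto (g b); exists (fiber_pair e). Qed.

Lemma resV_snd v : resB (p2 v) = resV v.
Proof. by rewrite -(res_fg (fiber_eq v)). Qed.

(** The inverses of the two components have the same image in [D], inverses being unique there, so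
    they form an element of the fibre product. *)
Lemma fiber_local v : resV v != 0 -> exists w, w * v = 1.
Proof.
move=> v0; have [a av] := A_local v0.
have [b bv] : exists b, b * p2 v = 1 by apply: B_local; rewrite resV_snd.
have e : f a = g b.
  rewrite -[f a]mulr1 -(rmorph1 g) -bv rmorphM -fiber_eq mulrC -mulrA -rmorphM.
  by rewrite [p1 v * a]mulrC av rmorph1 mulr1.
by exists (fiber_pair e); apply: fiber_ext.
Qed.

Local Notation K := (ker_module f).
Local Notation L := (ker_module g).
Local Notation KV := (restrict_scalars p1 K).
Local Notation LV := (restrict_scalars p2 L).

Let incK_eq (u : K) : f (val u) = g 0.
Proof. by rewrite rmorph0; exact/eqP/(valP u). Qed.
Let incL_eq (u : L) : f 0 = g (val u).
Proof. by rewrite rmorph0; exact/esym/eqP/(valP u). Qed.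
Let incKL_eq (u : KV * LV) : f (val (u.1 : K)) = g (val (u.2 : L)).
Proof. by rewrite (eqP (valP (u.2 : L))); exact/eqP/(valP (u.1 : K)). Qed.

Let incK_linear : linear (fun u : KV => fiber_pair (incK_eq u) : V^o).
Proof. by move=> c u v; apply: fiber_ext => //=; rewrite /fiber_snd /= mulr0 addr0. Qed.
Let incL_linear : linear (fun u : LV => fiber_pair (incL_eq u) : V^o).
Proof. by move=> c u v; apply: fiber_ext => //=; rewrite /fiber_fst /= mulr0 addr0. Qed.
Let incKL_linear : linear (fun u : (KV * LV)%type => fiber_pair (incKL_eq u) : V^o).
Proof. by move=> c u v; apply: fiber_ext. Qed.

Let p1_linear : linear (fun v : V^o => p1 v : restrict_scalars p1 A^o).
Proof. by move=> c u v; rewrite rmorphD rmorphM. Qed.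
Let p2_linear : linear (fun v : V^o => p2 v : restrict_scalars p2 B^o).
Proof. by move=> c u v; rewrite rmorphD rmorphM. Qed.

(** The kernel of [p1] is [L], which is Noetherian over [B] and hence over [V] because [p2] is onto;
    the quotient is [A]. *)
Lemma fiber_noetherian : noetherian_ring V.
Proof.
apply: (@noetherian_extension V V^o LV (restrict_scalars p1 A^o)
  (mk_linear incL_linear) (mk_linear p1_linear)).
- move=> v /= v0.
  have [u uE] : exists u : L, p2 v = val u.
    by apply/ker_moduleP; rewrite -fiber_eq v0 rmorph0.
  by exists u; apply: fiber_ext.
- by apply: noetherian_restrict fiber_snd_onto _; exact: noetherian_ker.
- exact: noetherian_restrict fiber_fst_onto _.
Qed.

Lemma fiber_series :
  [/\ poincare_hom resV p1 = 1 + fps_X * poincare resV LV,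
      poincare_hom resV p2 = 1 + fps_X * poincare resV KV &
      forall (M : lmodType V) (q : {linear V^o -> M}), onto q ->
        (forall v, q v = 0 <-> f (p1 v) = 0) ->
        poincare resV M = 1 + fps_X * (poincare resV KV + poincare resV LV)].
Proof.
have [FK _] : exists F : free_resolution KV, minimal_resolution resV F.
  apply: minimal_resolution_exists fiber_noetherian fiber_local _ _.
  by apply/noetherian_fg/noetherian_restrict/noetherian_ker => //; exact: fiber_fst_onto.
have [FL _] : exists F : free_resolution LV, minimal_resolution resV F.
  apply: minimal_resolution_exists fiber_noetherian fiber_local _ _.
  by apply/noetherian_fg/noetherian_restrict/noetherian_ker => //; exact: fiber_snd_onto.
have resK (u : K) : resA (val u) = 0.
  by rewrite (res_fg (incK_eq u)) rmorph0.
split.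
- apply: (@poincare_shift _ _ resV _ LV (mk_linear p1_linear) (mk_linear incL_linear)) => //.
  + exact: fiber_fst_onto.
  + by move=> u v /= /(congr1 p2) /val_inj.
  + move=> v /=; split=> [v0|[u ->]] //.
    have [u uE] : exists u : L, p2 v = val u.
      by apply/ker_moduleP; rewrite -fiber_eq v0 rmorph0.
    by exists u; apply: fiber_ext.
  + by move=> u; exact: rmorph0.
- apply: (@poincare_shift _ _ resV _ KV (mk_linear p2_linear) (mk_linear incK_linear)) => //.
  + exact: fiber_snd_onto.
  + by move=> u v /= /(congr1 p1) /val_inj.
  + move=> v /=; split=> [v0|[u ->]] //.
    have [u uE] : exists u : K, p1 v = val u.
      by apply/ker_moduleP; rewrite fiber_eq v0 rmorph0.
    by exists u; apply: fiber_ext.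
move=> M q q_onto qE; rewrite -(poincare_sum resV FK FL).
have [F _] := sum_resolution resV FK FL.
apply: (@poincare_shift _ _ resV M (KV * LV)%type q (mk_linear incKL_linear)) => //.
- move=> [u1 u2] [v1 v2] /= e; congr (_, _); apply: val_inj.
    exact: (congr1 p1 e).
  exact: (congr1 p2 e).
- move=> v; rewrite qE; split=> [v0|[u ->]] /=; last exact/eqP/(valP (u.1 : K)).
  have [u1 u1E] : exists u : K, p1 v = val u by apply/ker_moduleP.
  have [u2 u2E] : exists u : L, p2 v = val u by apply/ker_moduleP; rewrite -fiber_eq.
  by exists (u1, u2); apply: fiber_ext.
- by move=> u; exact: resK.
Qed.

(** This is the series of [D] over [V], presented through [A]; [fiber_series_snd] presents it
    through [B] with the same right-hand side. Their agreement yields [x a = z b] in the strongly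
    large case. *)
Lemma fiber_series_fst (M : lmodType A) (q : {linear A^o -> M}) :
  onto q -> (forall a, q a = 0 <-> f a = 0) ->
  poincare resV (restrict_scalars p1 M) =
    1 + fps_X * (poincare resV KV + poincare resV LV).
Proof.
move=> q_onto qE; have [_ _ eZ] := fiber_series.
have qL : linear (fun v : V^o => q (p1 v) : restrict_scalars p1 M).
  by move=> c u v; rewrite rmorphD rmorphM -[p1 c * p1 u]/(p1 c *: (p1 u : A^o)) linearP.
apply: (eZ _ (mk_linear qL)) => [m|v]; last exact: qE.
by have [a <-] := q_onto m; have [v <-] := fiber_fst_onto a; exists v.
Qed.

Lemma fiber_series_snd (M : lmodType B) (q : {linear B^o -> M}) :
  onto q -> (forall b, q b = 0 <-> g b = 0) ->
  poincare resV (restrict_scalars p2 M) =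
    1 + fps_X * (poincare resV KV + poincare resV LV).
Proof.
move=> q_onto qE; have [_ _ eZ] := fiber_series.
have qL : linear (fun v : V^o => q (p2 v) : restrict_scalars p2 M).
  by move=> c u v; rewrite rmorphD rmorphM -[p2 c * p2 u]/(p2 c *: (p2 u : B^o)) linearP.
apply: (eZ _ (mk_linear qL)) => [m|v]; last by rewrite fiber_eq; exact: qE.
by have [a <-] := q_onto m; have [v <-] := fiber_snd_onto a; exists v.
Qed.

Let ker_f_res a : f a = 0 -> resA a = 0.
Proof. by move=> fa; rewrite (@res_fg a 0) ?rmorph0. Qed.
Let ker_g_res b : g b = 0 -> resB b = 0.
Proof. by move=> gb; rewrite -(@res_fg 0 b) ?rmorph0. Qed.

Local Notation x := (poincare_hom resA f).
Local Notation z := (poincare_hom resB g).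

Lemma ker_f_resolution : exists F : free_resolution K, minimal_resolution resA F.
Proof.
by apply: (@minimal_resolution_exists k A resA A_noeth A_local K); exact/noetherian_fg/noetherian_ker.
Qed.

Lemma ker_g_resolution : exists F : free_resolution L, minimal_resolution resB F.
Proof.
by apply: (@minimal_resolution_exists k B resB B_noeth B_local L); exact/noetherian_fg/noetherian_ker.
Qed.

Lemma poincare_f (M : lmodType A) (q : {linear A^o -> M}) :
  onto q -> (forall a, q a = 0 <-> f a = 0) -> poincare resA M = x.
Proof.
have [F _] := ker_f_resolution => q_onto qE.
by rewrite (poincare_ker_shift ker_f_res F q_onto qE) (poincare_hom_shift f_onto ker_f_res F).
Qed.

Lemma poincare_g (M : lmodType B) (q : {linear B^o -> M}) :
  onto q -> (forall b, q b = 0 <-> g b = 0) -> poincare resB M = z.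
Proof.
have [F _] := ker_g_resolution => q_onto qE.
by rewrite (poincare_ker_shift ker_g_res F q_onto qE) (poincare_hom_shift g_onto ker_g_res F).
Qed.

(** With [x = 1 + t P] and [z = 1 + t Q], where [P] and [Q] are the series of the two kernels, the
    denominator is [1 - t^2 P Q]. *)
Lemma gluing_denominator_unit : x + z - x * z \is a GRing.unit.
Proof.
have [F _] := ker_f_resolution; have [G _] := ker_g_resolution.
rewrite (poincare_hom_shift f_onto ker_f_res F) (poincare_hom_shift g_onto ker_g_res G).
set P := poincare _ _; set Q := poincare _ _.
rewrite (_ : _ - _ = 1 - fps_X * (P * (fps_X * Q))); first exact: fps_unit_subX.
by ring.
Qed.

Lemma strongly_large_series (I : idealr A) (J : idealr B) :
  (forall a, a \in I <-> f a = 0) -> (forall b, b \in J <-> g b = 0) ->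
  poincare resV (restrict_scalars p1 (quot_module I)) =
    poincare resA (quot_module I) * poincare_hom resV p1 ->
  poincare resV (restrict_scalars p2 (quot_module J)) =
    poincare resB (quot_module J) * poincare_hom resV p2 ->
  poincare_hom resV p2 * (x + z - x * z) = x.
Proof.
move=> IE JE; have [q [q_onto qE]] := quot_projection I.
have [r [r_onto rE]] := quot_projection J.
have {}qE a : q a = 0 <-> f a = 0 by rewrite qE IE.
have {}rE b : r b = 0 <-> g b = 0 by rewrite rE JE.
rewrite (poincare_f q_onto qE) (poincare_g r_onto rE).
have [ea eb _] := fiber_series.
rewrite (fiber_series_fst q_onto qE) (fiber_series_snd r_onto rE).
move=> e1 e2; set b := poincare_hom resV p2 in eb e2 *.
set a := poincare_hom resV p1 in ea e1 *.
have e3 : a + b = 1 + x * a by rewrite -e1 ea eb; ring.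
have e4 : x * a = z * b by rewrite -e1 -e2.
(* The product is split into multiples of [a + b], [x * a] and [z * b - x * a], so that [e3] and
   [e4] apply. *)
rewrite (_ : b * _ = x * (a + b) - x * (x * a) + (z * b - x * a) - x * (z * b - x * a)).
  by rewrite e3 e4; ring.
by ring.
Qed.

Section Retract.
Variable phi : {rmorphism B -> A}.
Hypothesis f_phi : forall t, f (phi t) = g t.

Let sec t : V := fiber_pair (f_phi t).
Let sec_zmod : zmod_morphism sec.
Proof. by move=> s t; apply: fiber_ext => //=; rewrite /fiber_fst /= rmorphB. Qed.
Let sec_monoid : monoid_morphism sec.
Proof. by split=> [|s t]; apply: fiber_ext => //=; rewrite /fiber_fst /= ?rmorph1 ?rmorphM. Qed.

Definition fiber_section : {rmorphism B -> V} :=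
  HB.pack sec (GRing.isZmodMorphism.Build B V sec sec_zmod)
    (GRing.isMonoidMorphism.Build B V sec sec_monoid).

Lemma poincare_fiber_retract (M : lmodType B) :
  finitely_generated (fun _ : M => True) ->
  poincare resV (restrict_scalars p2 M) = poincare resB M * poincare_hom resV p2.
Proof.
move=> /(minimal_resolution_exists B_noeth B_local)[G minG].
have [F minF] : exists F : free_resolution (restrict_scalars p2 B^o), minimal_resolution resV F.
  apply: minimal_resolution_exists fiber_noetherian fiber_local _ _.
  by apply/noetherian_fg/noetherian_restrict => //; exact: fiber_snd_onto.
by apply: (@poincare_retract k V B p2 fiber_section resV resB M G F) => // v; exact: resV_snd.
Qed.

Lemma weakly_large_series :
  poincare resV KV = poincare resA K * poincare_hom resV p1 ->
  poincare_hom resV p2 * (x + z - x * z) = x.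
Proof.
have [ea eb _] := fiber_series => eK.
rewrite (poincare_fiber_retract (noetherian_fg (noetherian_ker (h := g) B_noeth))) in ea.
rewrite eK in eb; have [F _] := ker_f_resolution; have [G _] := ker_g_resolution.
have ex := poincare_hom_shift f_onto ker_f_res F.
have ez := poincare_hom_shift g_onto ker_g_res G.
set b := poincare_hom resV p2 in ea eb *; set a := poincare_hom resV p1 in ea eb.
set P := poincare resA K in ex eb; set Q := poincare resB L in ez ea.
(* The section gives the series of [L] over [V] as [Q * b], weak largeness gives that of [K] as
   [P * a]; eliminating [a] leaves an equation in [b]. *)
have eab : b = 1 + fps_X * P + fps_X * P * (fps_X * Q) * b by rewrite {1}eb ea; ring.
rewrite ex ez (_ : b * _ = b - fps_X * P * (fps_X * Q) * b); last by ring.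
by rewrite {1}eab; ring.
Qed.
End Retract.

End FiberProductSeries.

(** * Division of convergent power series *)

Lemma leq_exp2rW m n e : (m <= n -> m ^ e <= n ^ e)%N.
Proof. by case: e => [|e] mn; rewrite ?expn0 // leq_exp2r. Qed.

Section Weight.

Lemma prime_sequence : exists p : nat -> nat, (forall i, prime (p i)) /\ injective p.
Proof.
have [||p [_ pS]] := @dependent_choice_seq (fun=> nat) (fun _ p => prime p)
  (fun _ p q => p < q /\ prime q)%N; first by exists 2%N.
  by move=> _ p _; have [q pq q_pr] := prime_above p; exists q.
exists (p \o S); split=> [i|]; first exact: (pS i).2.
have mono : {homo p : i j / (i < j)%N}.
  by apply: homo_ltn => [x y z|i]; [exact: ltn_trans|exact: (pS i).1].
move=> i j /= e; apply: succn_inj; apply/eqP.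
by case: (ltngtP i.+1 j.+1) => // /mono; rewrite e ltnn.
Qed.

Definition nth_prime : nat -> nat := sval (cid prime_sequence).

Lemma nth_prime_prime i : prime (nth_prime i).
Proof. exact: (svalP (cid prime_sequence)).1. Qed.

Lemma nth_prime_gt0 i : (0 < nth_prime i)%N.
Proof. exact: prime_gt0 (nth_prime_prime i). Qed.

Lemma nth_prime_inj : injective nth_prime.
Proof. exact: (svalP (cid prime_sequence)).2. Qed.

Variable n : nat.
Implicit Types k : {ffun 'I_n -> nat}.

(* A multiplicative injection into nat: it orders the monomials with finitely
   many below each one, and turns convergence into polynomial growth. *)
Definition weight k : nat := \prod_(l < n) nth_prime l ^ k l.

Lemma weight_gt0 k : (0 < weight k)%N.
Proof. by rewrite prodn_gt0 // => l; rewrite expn_gt0 nth_prime_gt0. Qed.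

Lemma weightD j k : weight (madd j k) = (weight j * weight k)%N.
Proof. by rewrite /weight -big_split; apply: eq_bigr => l _; rewrite ffunE expnD. Qed.

Lemma logn_weight k (l : 'I_n) : logn (nth_prime l) (weight k) = k l.
Proof.
have -> : weight k = (nth_prime l ^ k l * \prod_(j < n | j != l) nth_prime j ^ k j)%N.
  by rewrite /weight (bigD1 l).
rewrite lognM ?expn_gt0 ?nth_prime_gt0 //; last first.
  by rewrite prodn_cond_gt0 // => j _; rewrite expn_gt0 nth_prime_gt0.
rewrite pfactorK ?nth_prime_prime // -[RHS]addn0; congr (_ + _)%N.
elim/big_rec: _ => [|j m jl IH]; first by rewrite logn1.
have [->|m_gt0] := posnP m; first by rewrite muln0 logn0.
rewrite lognM ?expn_gt0 ?nth_prime_gt0 // IH addn0.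
rewrite lognX logn_prime ?nth_prime_prime // (inj_eq nth_prime_inj).
by rewrite eq_sym (inj_eq val_inj) (negPf jl) muln0.
Qed.

Lemma weight_inj : injective weight.
Proof. by move=> j k e; apply/ffunP => l; rewrite -!logn_weight e. Qed.

(** Together with [weight_le_exp] this places the weight between two exponentials of the degree, so
    that geometric growth in the degree is polynomial growth in the weight. *)
Lemma exp2_mdegree_le k : (2 ^ mdegree k <= weight k)%N.
Proof.
rewrite /mdegree expn_sum; apply: leq_prod => l _.
by apply: leq_exp2rW; exact: prime_gt1 (nth_prime_prime l).
Qed.

Lemma weight_le_exp k : (weight k <= (\prod_(l < n) nth_prime l) ^ mdegree k)%N.
Proof.
rewrite /mdegree expn_sum; apply: leq_prod => l _.
apply: leq_exp2rW; rewrite (bigD1 l) //= leq_pmulr // prodn_cond_gt0 // => j _.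
by rewrite nth_prime_gt0.
Qed.

End Weight.

Section ConvergentSeries.
Variables (R : realType) (n : nat).
Local Notation K := (Cplx R).
Local Notation mi := {ffun 'I_n -> nat}.
Implicit Types (c d : mi -> K) (k u : mi).

(** Equivalent to a Cauchy estimate on some polydisc, by [convergentP]. Natural constants let most
    estimates of the division take place in [nat]. *)
Definition convergent c : Prop :=
  exists N A : nat, forall k, `|c k| <= (N * weight k ^ A)%:R.

Lemma Cplx_bound (x : K) : 0 <= x -> exists N : nat, x <= N%:R.
Proof.
move=> x0; have xE : x = (complex.Re x)%:C%C.
  by move: x0; case: x => a b; rewrite lecE /= => /andP[/eqP -> _].
exists (Num.bound (complex.Re x)); rewrite xE -(rmorph_nat (real_complex R)) lecR.
apply: ltW; apply: le_lt_trans (archi_boundP _); rewrite ?ler_norm //.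
by move: x0; rewrite lecE => /andP[].
Qed.

Lemma convergentP c : convergent c <->
  exists r M : K, 0 < r /\ forall k, `|c k| * r ^+ mdegree k <= M.
Proof.
split=> [[N [A cN]]|[r [M [r0 cM]]]].
  pose P := (\prod_(l < n) nth_prime l)%N.
  have P0 : (0 < P)%N by rewrite prodn_cond_gt0 // => l _; exact: nth_prime_gt0.
  have PA0 : (0 : K) < (P ^ A)%:R by rewrite ltr0n expn_gt0 P0.
  exists (P ^ A)%:R^-1, N%:R; split=> [|k]; first by rewrite invr_gt0.
  rewrite exprVn ler_pdivrMr ?exprn_gt0 //; apply: le_trans (cN k) _.
  rewrite -natrX -natrM ler_nat leq_mul2l; apply/orP; right.
  by rewrite -expnM mulnC expnM; apply: leq_exp2rW; exact: weight_le_exp.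
have [A Ar] := half_lt r0.
have M0 : 0 <= M by apply: le_trans (cM [ffun=> 0%N]); rewrite mulr_ge0 ?exprn_ge0 // ltW.
have [N MN] := Cplx_bound M0; exists N, A => k.
have h2 : (0 : K) < 2^-1 ^+ A by rewrite exprn_gt0 // invr_gt0.
have : `|c k| * (2^-1 ^+ A) ^+ mdegree k <= N%:R.
  apply: le_trans MN; apply: le_trans (cM k); rewrite ler_wpM2l //.
  by apply: lerXn2r; rewrite ?nnegrE ltW.
rewrite -exprM exprVn ler_pdivrMr ?exprn_gt0 // => /le_trans; apply.
rewrite -natrX -natrM ler_nat leq_mul2l; apply/orP; right.
by rewrite mulnC expnM; apply: leq_exp2rW; exact: exp2_mdegree_le.
Qed.

Lemma conv_delta (e : mi) d k :
  conv (fun u => (u == e)%:R) d k = if mle e k then d (msub k e) else 0.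
Proof.
rewrite /conv /conv_box; case: ifPn => [ek|ek].
  have /in_boxP[i0 eE] : in_box (mdegree k).+1 e.
    apply/forallP => l; apply: leq_ltn_trans (forallP ek l) _.
    exact: (forallP (in_box_mdegree k)).
  subst e; rewrite (bigD1 i0) //= big1 ?addr0 => [|i ii0]; last first.
    by rewrite /conv_term (inj_eq (@of_box_inj _ _)) (negPf ii0) mul0r if_same.
  by rewrite /conv_term ek eqxx mul1r.
rewrite big1 // => i _; rewrite /conv_term; case: eqP => [->|_]; last by rewrite mul0r if_same.
by rewrite (negPf ek).
Qed.

Lemma convDl c c' d k :
  conv (fun u => c u + c' u) d k = conv c d k + conv c' d k.
Proof.
rewrite /conv /conv_box -big_split; apply: eq_bigr => i _.
by rewrite /conv_term /=; case: ifP => _; [rewrite mulrDl|rewrite addr0].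
Qed.

(** Bernoulli's inequality for [1 + 1/E], cleared of denominators. It serves to make
    [E.+1 ^ T / E ^ T] exceed a given constant. *)
Lemma bernoulli_nat E T : (E ^ T * (E + T) <= E * E.+1 ^ T)%N.
Proof.
elim: T => [|T IH]; first by rewrite addn0 mulnC.
rewrite !expnS; move: IH; move: (E ^ T)%N (E.+1 ^ T)%N => a b IH.
apply: (@leq_trans (a * (E + T) * E.+1)); first by nia.
by apply: leq_trans (leq_mul IH (leqnn E.+1)) _; rewrite -mulnA [(b * _)%N]mulnC.
Qed.

Section Division.
Variables (s : nat) (e : 'I_s -> mi) (F : 'I_s -> mi -> K) (q : mi -> K).
Hypothesis F1 : forall i, F i (e i) = 1.
Hypothesis F0 : forall i k, (weight k < weight (e i))%N -> F i k = 0.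

(** Each exponent divisible by some [e i] is assigned to one divisor only, so that a single function
    [h] can encode all quotients. *)
Definition leading_divisor k : option 'I_s := [pick i | mle (e i) k].

Definition tail i u : K :=
  if u == e i then 0 else F i u.

Definition quotient (h : mi -> K) i : mi -> K := fun d : mi =>
  if leading_divisor (madd (e i) d) == Some i then h (madd (e i) d) else 0.

(* The division of q is solved by a fixpoint h of this map, which carries the
   coefficients of all quotients.  The value at k involves h only in smaller
   weight; in the norm sup_k |h k| / weight k ^ S with S large, the part that
   depends on h has at most half the norm of h. *)
Definition reduction (h : mi -> K) : mi -> K := fun k =>
  q k - \sum_i conv (tail i) (quotient h i) k.

Lemma tail_weight i u : tail i u != 0 -> (weight (e i) < weight u)%N.
Proof.
rewrite /tail; case: (eqVneq u (e i)) => [_|ue Fu]; first by rewrite eqxx.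
rewrite ltn_neqAle eq_sym (inj_eq (@weight_inj _)) ue leqNgt.
by apply: contraNN Fu => /F0 ->.
Qed.

Lemma weight_quotient i u k : mle u k ->
  (weight (madd (e i) (msub k u)) * weight u = weight (e i) * weight k)%N.
Proof. by move=> uk; rewrite weightD -mulnA [(_ * weight u)%N]mulnC -weightD maddK. Qed.

(** A nonzero tail coefficient sits at some [u] of larger weight than [e i]; since weights multiply,
    [h] is then evaluated at smaller weight than [k]. *)
Lemma reduction_local h h' k :
  (forall j, (weight j < weight k)%N -> h j = h' j) -> reduction h k = reduction h' k.
Proof.
move=> hh; congr (_ - _); apply: eq_bigr => i _; apply: eq_bigr => u _.
rewrite /conv_term; case: ifP => // uk; have [->|tu] := eqVneq (tail i (of_box u)) 0.
  by rewrite !mul0r.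
congr (_ * _); rewrite /quotient; case: ifP => // _; apply: hh.
have := weight_quotient i uk; have := tail_weight tu.
have := weight_gt0 (of_box u); have := weight_gt0 k; nia.
Qed.

(** The value at [k] is stationary after [weight k] + 1 iterations, so the fixpoint is obtained
    without any convergence argument. *)
Definition reduction_limit : mi -> K := fun k => iter (weight k).+1 reduction (fun=> 0) k.

Lemma reduction_stable t t' k : (weight k < t)%N -> (weight k < t')%N ->
  iter t reduction (fun=> 0) k = iter t' reduction (fun=> 0) k.
Proof.
elim: t t' k => // t IH [//|t'] k; rewrite !ltnS => kt kt' /=.
by apply: reduction_local => j jk; apply: IH; [apply: leq_trans kt|apply: leq_trans kt'].
Qed.

Lemma reduction_fixpoint k : reduction_limit k = reduction reduction_limit k.
Proof. by apply: reduction_local => j jk; apply: reduction_stable. Qed.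

Lemma division_eq k : (exists i, mle (e i) k) ->
  q k = \sum_i conv (F i) (quotient reduction_limit i) k.
Proof.
move=> ek; set h := reduction_limit.
have FE i : F i = fun u => (u == e i)%:R + tail i u.
  apply/funext => u; rewrite /tail; case: eqVneq => [->|_]; last by rewrite add0r.
  by rewrite F1 addr0.
under eq_bigr do rewrite FE convDl conv_delta.
(* Among the leading monomials only the one of the assigned divisor contributes, with value [h k];
   the tails are what the fixpoint equation subtracts from [q k]. *)
rewrite big_split /= (_ : \sum_i (if _ then _ else _) = h k).
  by rewrite /h reduction_fixpoint /reduction subrK.
rewrite -big_mkcond /=.
have [i0 i0E] : exists i, leading_divisor k = Some i.
  rewrite /leading_divisor; case: pickP => [i _|no]; first by exists i.
  by case: ek => i; rewrite no.
have ei0 : mle (e i0) k.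
  by move: i0E; rewrite /leading_divisor; case: pickP => // i ei [<-].
rewrite (bigD1 i0) //= big1 ?addr0 => [|i /andP[eik ii0]].
  by rewrite /quotient maddK // i0E eqxx.
by rewrite /quotient maddK // i0E (inj_eq Some_inj) eq_sym (negPf ii0).
Qed.

Section Bound.
Variables (N A C T E : nat).
Hypothesis FN : forall i k, `|F i k| <= (N * weight k ^ A)%:R.
Hypothesis eE : forall i, (weight (e i) <= E)%N.
(** [A] absorbs the growth of [F], the summand 1 makes the sum over exponents bounded, and [T]
    provides the contraction. *)
Let S := (A + 1 + T)%N.

Lemma quotient_term_bound h i u k : mle u k ->
  (forall j, `|h j| <= (C * weight j ^ S)%:R) ->
  `|tail i u * quotient h i (msub k u)| <=
    (C * N * (E * weight k) ^ S)%:R / (E.+1 ^ T)%:R * 2^-1 ^+ mdegree u.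
Proof.
move=> uk hC; have [->|tu] := eqVneq (tail i u) 0.
  by rewrite mul0r normr0 !mulr_ge0 ?invr_ge0 // exprn_ge0 ?invr_ge0.
set j := madd (e i) (msub k u).
have jE := weight_quotient i uk; rewrite -/j in jE.
(* The weight of [u] is at least [weight (e i) + 1] and [weight (e i)] is at most [E], which gives
   the ratio [E / (E + 1)]. *)
have jE' : (weight j * E.+1 <= E * weight k)%N.
  have h1 : (weight j * (weight (e i)).+1 <= weight (e i) * weight k)%N.
    by rewrite -jE leq_mul2l tail_weight ?orbT.
  have := eE i; move: h1; move: (weight j) (weight (e i)) (weight k) => x y z; nia.
have natB : (weight u ^ A * weight j ^ S * (E.+1 ^ T * weight u) <= (E * weight k) ^ S)%N.
  have -> : (weight u ^ A * weight j ^ S * (E.+1 ^ T * weight u) =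
      (weight j * weight u) ^ (A + 1) * (weight j * E.+1) ^ T)%N.
    by rewrite /S !expnMn !expnD !expn1; ring.
  rewrite /S [in leqRHS]expnD; apply: leq_mul; apply: leq_exp2rW => //.
  by rewrite jE leq_mul2r eE orbT.
have h1 : `|tail i u| <= (N * weight u ^ A)%:R.
  by apply: le_trans (FN i u); rewrite /tail; case: ifP; rewrite ?normr0.
have h2 : `|quotient h i (msub k u)| <= (C * weight j ^ S)%:R.
  by rewrite /quotient -/j; case: ifP => _; rewrite ?normr0.
rewrite normrM; apply: le_trans (ler_pM _ _ h1 h2) _ => //.
rewrite exprVn -mulrA -invfM -natrX -!natrM ler_pdivlMr; last first.
  by rewrite ltr0n muln_gt0 !expn_gt0.
rewrite -natrM ler_nat.
(* The spare factor [weight u] dominates the power of 2 that makes the terms summable. *)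
apply: (@leq_trans (C * N * (weight u ^ A * weight j ^ S * (E.+1 ^ T * weight u))))%N; last first.
  by rewrite leq_mul2l natB orbT.
rewrite [leqRHS](_ : _ =
  N * weight u ^ A * (C * weight j ^ S) * (E.+1 ^ T * weight u))%N; last by ring.
by rewrite !leq_mul2l exp2_mdegree_le !orbT.
Qed.

(** Half of [C = 2 N] pays for [q]. The hypothesis on [T] lets the other half pay for the [s] tails,
    whose factors [2^-1 ^+ mdegree u] sum to at most [2 ^ n] each. *)
Lemma reduction_bound h :
  (forall k, `|q k| <= (N * weight k ^ A)%:R) -> C = (2 * N)%N ->
  (2 * (s * N * 2 ^ n * E ^ (A + 1)) * E ^ T <= E.+1 ^ T)%N ->
  (forall j, `|h j| <= (C * weight j ^ S)%:R) ->
  forall k, `|reduction h k| <= (C * weight k ^ S)%:R.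
Proof.
move=> qN CE TE hC k; apply: le_trans (ler_normB _ _) _.
set B := (C * N * (E * weight k) ^ S)%:R / (E.+1 ^ T)%:R : K.
have B0 : 0 <= B by rewrite divr_ge0.
have sumB : `|\sum_i conv (tail i) (quotient h i) k| <= B * (s * 2 ^ n)%:R.
  have -> : B * (s * 2 ^ n)%:R = \sum_(i < s) B * 2 ^+ n.
    by rewrite sumr_const card_ord natrM natrX mulrCA mulr_natl.
  apply: le_trans (ler_norm_sum _ _ _) _; apply: ler_sum => i _.
  apply: (@le_trans _ _ (B * \sum_(u : {ffun 'I_n -> 'I_(mdegree k).+1}) 2^-1 ^+ mdegree (of_box u))).
    rewrite mulr_sumr; apply: le_trans (ler_norm_sum _ _ _) _; apply: ler_sum => u _.
    rewrite /conv_term; case: ifP => [uk|_]; first exact: quotient_term_bound.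
    by rewrite normr0 mulr_ge0 // exprn_ge0 // invr_ge0.
  by rewrite ler_wpM2l // sum_half_le.
apply: le_trans (lerD (qN k) sumB) _.
have -> : (C * weight k ^ S)%:R = (N * weight k ^ S)%:R + (N * weight k ^ S)%:R :> K.
  by rewrite CE -natrD; congr (_%:R); ring.
apply: lerD.
  rewrite ler_nat leq_mul2l; apply/orP; right; rewrite /S -addnA leq_pexp2l ?weight_gt0 //.
  by rewrite leq_addr.
rewrite mulrAC ler_pdivrMr ?ltr0n ?expn_gt0 // -!natrM ler_nat.
rewrite (_ : C * N * _ * _ = N * weight k ^ S * (2 * (s * N * 2 ^ n * E ^ (A + 1)) * E ^ T))%N.
  by rewrite leq_mul2l TE orbT.
by rewrite CE expnMn /S (expnD E); ring.
Qed.

End Bound.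

End Division.

(** At exponents divisible by no [e i] nothing is asserted: there the difference of the two sides is
    the remainder of the division. *)
Theorem convergent_division (s : nat) (e : 'I_s -> mi) (F : 'I_s -> mi -> K) (g : mi -> K) :
  (forall i, F i (e i) = 1) ->
  (forall i k, (weight k < weight (e i))%N -> F i k = 0) ->
  (forall i, convergent (F i)) -> convergent g ->
  exists2 q : 'I_s -> mi -> K, forall i, convergent (q i) &
    forall k, (exists i, mle (e i) k) -> g k = \sum_i conv (F i) (q i) k.
Proof.
move=> F1 F0 /choice[N /choice[A FNA]] [N0 [A0 gN]].
pose N' := (N0 + \sum_i N i)%N; pose A' := (A0 + \sum_i A i)%N.
pose E := (\sum_i weight (e i)).+1%N.
(* [T] is [E] times the constant to be beaten, which Bernoulli's inequality turns into a gain of one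
   plus that constant. *)
pose T := (2 * (s * N' * 2 ^ n * E ^ (A' + 1)) * E)%N.
have mono (M M' B B' : nat) k : (M <= M' -> B <= B' ->
    (M * weight k ^ B)%:R <= (M' * weight k ^ B')%:R :> K)%N.
  by move=> MM BB; rewrite ler_nat leq_mul // leq_pexp2l ?weight_gt0.
have FN i k : `|F i k| <= (N' * weight k ^ A')%:R.
  by apply: le_trans (FNA i k) (mono _ _ _ _ _ _ _); rewrite /N' /A' (bigD1 i) //=; lia.
have gN' k : `|g k| <= (N' * weight k ^ A')%:R.
  by apply: le_trans (gN k) (mono _ _ _ _ _ _ _); rewrite leq_addr.
have eE i : (weight (e i) <= E)%N by rewrite /E (bigD1 i) //=; lia.
have TE : (2 * (s * N' * 2 ^ n * E ^ (A' + 1)) * E ^ T <= E.+1 ^ T)%N.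
  set L := (2 * _)%N; have B : (E ^ T * (1 + L) * E <= E.+1 ^ T * E)%N.
    by rewrite -mulnA mulnDl mul1n [leqRHS]mulnC; exact: bernoulli_nat.
  rewrite leq_mul2r /= in B; apply: leq_trans B.
  by rewrite mulnC leq_mul2l leq_addl orbT.
pose S := (A' + 1 + T)%N; pose h := reduction_limit e F g.
(* All iterates starting from 0 obey one bound, and each value of [h] is a value of an iterate. *)
have iterB t k : `|iter t (reduction e F g) (fun=> 0) k| <= (2 * N' * weight k ^ S)%:R.
  elim: t k => [|t IH] k; first by rewrite normr0 ler0n.
  exact: (reduction_bound F0 FN eE gN' (erefl _) TE IH k).
have hB k : `|h k| <= (2 * N' * weight k ^ S)%:R by exact: iterB.
exists (quotient e h) => [i|]; last exact: division_eq.
exists (2 * N' * weight (e i) ^ S)%N, S => d; rewrite /quotient; case: ifP => _.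
  by apply: le_trans (hB _) _; rewrite weightD expnMn mulnA.
by rewrite normr0.
Qed.

End ConvergentSeries.

(** * Local rings of germs *)

Section Dickson.
Local Open Scope classical_set_scope.

(** Each index is the position of a minimum of the values still ahead, so later choices cannot be
    smaller. *)
Lemma monotone_subsequence (v : nat -> nat) : exists phi : nat -> nat,
  {homo phi : s t / (s < t)%N} /\ {homo (v \o phi) : s t / (s <= t)%N}.
Proof.
have argmin m : exists i, (m <= i)%N /\ forall j, (m <= j)%N -> (v i <= v j)%N.
  have ex : exists a, `[< exists2 i, (m <= i)%N & v i = a >].
    by exists (v m); apply/asboolP; exists m.
  case: (ex_minnP ex) => _ /asboolP[i mi <-] min; exists i; split=> // j mj.
  by apply: min; apply/asboolP; exists j.
have [||phi [_ phiS]] := @dependent_choice_seq (fun=> nat)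
    (fun _ i => forall j, (i <= j)%N -> (v i <= v j)%N)
    (fun _ i j => i < j /\ v i <= v j)%N.
- by have [i [_ iE]] := argmin 0%N; exists i => j _; exact: iE.
- move=> _ i Pi; have [j [ij jE]] := argmin i.+1; exists j; split.
    by split=> //; apply: Pi; exact: ltnW.
  by move=> j' jj'; apply: jE; exact: leq_trans ij jj'.
exists phi; split.
  by apply: homo_ltn => [x y z|i]; [exact: ltn_trans|exact: (phiS i).1].
by apply: homo_leq => [x|x y z|i] //=; [exact: leq_trans|exact: (phiS i).2].
Qed.

Variable n : nat.
Local Notation mi := {ffun 'I_n -> nat}.

Lemma mle_subsequence (u : nat -> mi) : exists phi : nat -> nat,
  {homo phi : s t / (s < t)%N} /\ {homo (u \o phi) : s t / (s <= t)%N >-> mle s t}.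
Proof.
suff [phi [mono uphi]] : exists phi : nat -> nat, {homo phi : s t / (s < t)%N} /\
    forall l, l \in enum 'I_n -> {homo (fun t => u (phi t) l) : s t / (s <= t)%N}.
  exists phi; split=> // s t st; apply/forallP => l; apply: uphi => //.
  by rewrite mem_enum.
elim: (enum 'I_n) => [|l ls [phi [mono uphi]]]; first by exists id; split=> [s t|l]; rewrite ?in_nil.
have [psi [psi_mono lpsi]] := monotone_subsequence (fun t => u (phi t) l).
have psi_le : {homo psi : s t / (s <= t)%N} := ltnW_homo psi_mono.
exists (phi \o psi); split=> [s t st|l']; first by apply: mono; exact: psi_mono.
rewrite inE => /orP[/eqP -> //|l'ls] s t /psi_le; exact: uphi.
Qed.

(** If no finite subset sufficed, one could choose exponents successively, none of them divisible by
    an earlier one; a subsequence increasing in every coordinate contradicts this. *)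
Lemma dickson (E : mi -> Prop) : exists s (e : 'I_s -> mi),
  (forall i, E (e i)) /\ forall k, E k -> exists i, mle (e i) k.
Proof.
apply: contrapT => noE.
have next (l : seq mi) : (forall k, k \in l -> E k) ->
    exists k, E k /\ forall j, j \in l -> ~~ mle j k.
  move=> lE; apply: contrapT => nok; apply: noE.
  exists (size l), (fun i => nth [ffun=> 0%N] l i); split=> [i|k Ek].
    by apply: lE; exact: mem_nth.
  apply: contrapT => noi; apply: nok; exists k; split=> // j jl.
  apply/negP => jk; apply: noi.
  have lt : (index j l < size l)%N by rewrite index_mem.
  by exists (Ordinal lt); rewrite /= nth_index.
have [||f [_ fS]] := @dependent_choice_seq (fun=> seq mi)
    (fun _ l => forall k, k \in l -> E k)
    (fun _ l l' => exists k, l' = rcons l k /\ forall j, j \in l -> ~~ mle j k).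
- by exists [::].
- move=> _ l lE; have [k [Ek kl]] := next l lE; exists (rcons l k); split.
    by exists k.
  by move=> j; rewrite mem_rcons inE => /orP[/eqP ->|/lE].
have [u uP] := choice fS.
have mem s t : (s < t)%N -> u s \in f t.
  elim: t => // t IH; rewrite ltnS leq_eqVlt (uP t).1 mem_rcons inE.
  by move=> /orP[/eqP ->|/IH ->]; rewrite ?eqxx ?orbT.
have [phi [mono uphi]] := mle_subsequence u.
have /negP := (uP (phi 1%N)).2 (u (phi 0%N)) (mem _ _ (mono _ _ (ltnSn 0))).
by apply; exact: uphi.
Qed.

End Dickson.

(** * Sums of convergent power series *)

Section SeriesSums.
Local Open Scope classical_set_scope.
Variables (R : realType).
Local Notation K := (Cplx R).

Lemma monotone_bounded_cvg (u : nat -> K) (B : K) :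
  (forall N, 0 <= u N) -> (forall N, u N <= u N.+1) -> (forall N, u N <= B) ->
  exists a : K, u @ \oo --> a.
Proof.
move=> u0 umono uB; pose v N := complex.Re (u N).
have uv N : u N = (v N)%:C%C.
  by move: (u0 N); rewrite /v; case: (u N) => a b; rewrite lecE /= => /andP[/eqP -> _].
have vmono : nondecreasing_seq v.
  by apply/nondecreasing_seqP => N; have := umono N; rewrite !uv lecR.
have /nondecreasing_is_cvgn vcvg := vmono.
have ubv : has_ubound (range v).
  by exists (complex.Re B) => _ [N _ <-]; have := uB N; rewrite lecE => /andP[].
have {}/vcvg vl := ubv.
exists (limn v)%:C%C; apply/cvgrPdist_lt => e e0.
have eE : e = (complex.Re e)%:C%C.
  by move: e0; case: e => a b; rewrite ltcE /= => /andP[/eqP -> _].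
have a0 : 0 < complex.Re e by move: e0; rewrite ltcE => /andP[].
have /cvgrPdist_lt/(_ _ a0) := vl; apply: filterS => N.
by rewrite uv -rmorphB eE normc_def /= expr0n addr0 sqrtr_sqr ltcR.
Qed.

Variable n : nat.
Local Notation mi := {ffun 'I_n -> nat}.
Implicit Types (c d : mi -> K) (k : mi) (w : 'rV[K]_n).

Lemma box_sum_mono (p : mi -> K) N : (forall k, 0 <= p k) ->
  \sum_(k : {ffun 'I_n -> 'I_N.+1}) p (of_box k) <=
  \sum_(k : {ffun 'I_n -> 'I_N.+2}) p (of_box k).
Proof.
move=> p0; pose p' k := if in_box N.+1 k then p k else 0.
have -> : \sum_(k : {ffun 'I_n -> 'I_N.+1}) p (of_box k) =
    \sum_(k : {ffun 'I_n -> 'I_N.+1}) p' (of_box k).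
  by apply: eq_bigr => k _; rewrite /p' ifT //; apply/in_boxP; exists k.
rewrite -(@box_widen _ _ N N.+1) => [|//|k /negPf]; last by rewrite /p' => ->.
by apply: ler_sum => k _; rewrite /p'; case: ifP.
Qed.

Lemma nonneg_box_cvg (p : mi -> K) (M : K) :
  (forall k, 0 <= p k) -> (forall k, p k <= M * 2^-1 ^+ mdegree k) ->
  exists a : K, (fun N => \sum_(k : {ffun 'I_n -> 'I_N}) p (of_box k)) @ \oo --> a.
Proof.
move=> p0 pM; have M0 : 0 <= M.
  by have := le_trans (p0 _) (pM [ffun=> 0%N]); rewrite /mdegree big1 ?mulr1 // => l; rewrite ffunE.
have [|N|N|a al] := @monotone_bounded_cvg
  (fun N => \sum_(k : {ffun 'I_n -> 'I_N.+1}) p (of_box k)) (M * 2 ^+ n).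
- by move=> N; exact: sumr_ge0.
- exact: box_sum_mono.
- apply: (@le_trans _ _ (M * \sum_(k : {ffun 'I_n -> 'I_N.+1}) 2^-1 ^+ mdegree (of_box k))).
    by rewrite mulr_sumr; apply: ler_sum => k _.
  by rewrite ler_wpM2l // sum_half_le.
by exists a; rewrite -cvg_shiftS.
Qed.

(** The real part of [t] is the difference of [Re t + |t|] and [|t|], both nonnegative with bounded
    sums; the imaginary part is minus the real part of [i t]. *)
Lemma abs_box_cvg (t : mi -> K) (M : K) : (forall k, `|t k| <= M * 2^-1 ^+ mdegree k) ->
  exists a : K, (fun N => \sum_(k : {ffun 'I_n -> 'I_N}) t (of_box k)) @ \oo --> a.
Proof.
move=> tM.
have real_part (f : K -> K) : (forall z, f z \is Num.real) -> (forall z, `|f z| <= `|z|) ->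
    exists a : K, (fun N => \sum_(k : {ffun 'I_n -> 'I_N}) f (t (of_box k))) @ \oo --> a.
  move=> f_real f_le.
  have [k|k|a al] := @nonneg_box_cvg (fun k => `|t k|) M => //.
  have [k|k|b bl] := @nonneg_box_cvg (fun k => f (t k) + `|t k|) (M + M).
  - by rewrite -lerBlDr sub0r; have := f_le (t k); rewrite real_ler_norml ?f_real // => /andP[].
  - rewrite mulrDl; apply: lerD => //; apply: le_trans (tM k).
    by have := f_le (t k); rewrite real_ler_norml ?f_real // => /andP[].
  exists (b - a).
  have -> : (fun N => \sum_(k : {ffun 'I_n -> 'I_N}) f (t (of_box k))) =
      (fun N => \sum_(k : {ffun 'I_n -> 'I_N}) (f (t (of_box k)) + `|t (of_box k)|)
        - \sum_(k : {ffun 'I_n -> 'I_N}) `|t (of_box k)|).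
    by apply/funext => N; rewrite -sumrB; apply: eq_bigr => k _; rewrite addrK.
  exact: cvgB bl al.
have Re_le (z : K) : `|'Re z| <= `|z| by rewrite leif_normC_Re_Creal.
have [z|//|a al] := real_part (fun z => 'Re z); first exact: Creal_Re.
have [z|z|b bl] := real_part (fun z => 'Re ('i * z)); first exact: Creal_Re.
  by apply: le_trans (Re_le _) _; rewrite normrM normCi mul1r.
exists (a - 'i * b).
have -> : (fun N => \sum_(k : {ffun 'I_n -> 'I_N}) t (of_box k)) =
    (fun N => \sum_(k : {ffun 'I_n -> 'I_N}) 'Re (t (of_box k))
      - 'i * \sum_(k : {ffun 'I_n -> 'I_N}) 'Re ('i * t (of_box k))).
  apply/funext => N; rewrite mulr_sumr -sumrB; apply: eq_bigr => k _.
  by rewrite ReMil mulrN opprK -Crect.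
exact: cvgB al (cvgM (cvg_cst ('i : K)) bl).
Qed.

Lemma series_sum_exists c : convergent c ->
  exists2 r : K, 0 < r & forall w, (forall l, `|w 0 l| <= r) -> exists a, series_sum c w a.
Proof.
move=> /convergentP[r [M [r0 cM]]]; exists (r / 2) => [|w wr]; first exact: divr_gt0.
apply: (@abs_box_cvg (fun k => c k * mpow w k) M) => k; rewrite normrM.
apply: (@le_trans _ _ (`|c k| * (r / 2) ^+ mdegree k)).
  by rewrite ler_wpM2l // norm_mpow_le.
by rewrite exprMn mulrA ler_wpM2r // exprn_ge0 // invr_ge0.
Qed.

Lemma series_sum_unique c w a b : series_sum c w a -> series_sum c w b -> a = b.
Proof. by move=> ca cb; apply: cvg_unique ca cb; exact: norm_hausdorff. Qed.

(** The product of two partial sums over a box differs from the partial sum of the Cauchy product by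
    an error that decays geometrically in the side of the box. *)
Lemma series_sum_conv c d : convergent c -> convergent d ->
  exists2 r : K, 0 < r & forall w, (forall l, `|w 0 l| <= r) ->
    forall a b, series_sum c w a -> series_sum d w b -> series_sum (conv c d) w (a * b).
Proof.
move=> /convergentP[r [M [r0 cM]]] /convergentP[s [M' [s0 dM]]].
have [t [t0 tr ts]] := common_radius r0 s0.
have {}cM := bound_weaken t0 tr cM; have {}dM := bound_weaken t0 ts dM.
exists (t / 4) => [|w wt a b ca db]; first exact: divr_gt0.
have e0 : (fun N => box_sum c w N * box_sum d w N - box_sum (conv c d) w N) @ \oo --> (0 : K).
  apply/cvgr0Pnorm_lt => e e0.
  have B0 : 0 <= M * M' * 4 ^+ n.
    rewrite !mulr_ge0 ?exprn_ge0 //.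
    - by apply: le_trans (cM [ffun=> 0%N]); rewrite mulr_ge0 ?exprn_ge0 // ltW.
    - by apply: le_trans (dM [ffun=> 0%N]); rewrite mulr_ge0 ?exprn_ge0 // ltW.
  pose L := M * M' * 4 ^+ n + 1.
  have L0 : 0 < L by rewrite ltr_wpDl.
  have [N0 hN] := half_lt (divr_gt0 e0 L0).
  exists N0.+1 => // -[//|N] /= NN0.
  apply: le_lt_trans (box_sum_mul_bound N t0 cM dM wt) _.
  apply: le_lt_trans (_ : L * 2^-1 ^+ N0 < e); last by rewrite mulrC -ltr_pdivlMr.
  apply: ler_pM; rewrite ?exprn_ge0 ?invr_ge0 // ?lerDl //.
  by apply: ler_wiXn2l; rewrite ?invr_ge0 // ?invf_le1 ?ltr0n ?ler1n // ltnW.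
pose S N := box_sum c w N * box_sum d w N.
have E : box_sum (conv c d) w = (fun N => S N - (S N - box_sum (conv c d) w N)).
  by apply/funext => N; rewrite subKr.
rewrite /series_sum E -[X in _ --> X]subr0.
by apply: cvgB e0; exact: cvgM ca db.
Qed.

Lemma series_sumD c d w a b : series_sum c w a -> series_sum d w b ->
  series_sum (fun k => c k + d k) w (a + b).
Proof.
move=> ca db; rewrite /series_sum.
have -> : box_sum (fun k => c k + d k) w = (fun N => box_sum c w N + box_sum d w N).
  by apply/funext => N; rewrite /box_sum -big_split; apply: eq_bigr => k _; rewrite mulrDl.
exact: cvgD ca db.
Qed.

Lemma series_sumZ c w a (t : K) : series_sum c w a ->
  series_sum (fun k => t * c k) w (t * a).
Proof.
move=> ca; rewrite /series_sum.
have -> : box_sum (fun k => t * c k) w = (fun N => t * box_sum c w N).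
  by apply/funext => N; rewrite /box_sum mulr_sumr; apply: eq_bigr => k _; rewrite mulrA.
exact: cvgM (cvg_cst t) ca.
Qed.

Lemma series_sum_at0 c : series_sum c 0 (c [ffun=> 0%N]).
Proof.
apply: cvg_near_cst; exists 1%N => // -[//|N] _ /=.
rewrite /box_sum (bigD1 [ffun=> ord0]) //= big1 ?addr0 => [|k kz].
  have -> : of_box [ffun=> ord0 : 'I_N.+1] = [ffun=> 0%N] :> mi.
    by apply/ffunP => l; rewrite !ffunE.
  by rewrite /mpow big1 ?mulr1 // => l _; rewrite ffunE.
have [l kl] : exists l, k l != ord0.
  apply: contrapT => no; case/eqP: kz; apply/ffunP => l; rewrite ffunE.
  by apply: contrapT => /eqP kl; apply: no; exists l.
rewrite /mpow (bigD1 l) //= ffunE mxE expr0n.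
by rewrite (negPf (_ : k l != 0 :> nat)) ?mul0r ?mulr0.
Qed.

End SeriesSums.

Section ConvergentOperations.
Variables (R : realType) (n : nat).
Local Notation K := (Cplx R).
Implicit Types c d : {ffun 'I_n -> nat} -> K.

Lemma convergentD c d : convergent c -> convergent d ->
  convergent (fun k => c k + d k).
Proof.
move=> [N [A cN]] [N' [A' dN]]; exists (N + N')%N, (A + A')%N => k.
apply: le_trans (ler_normD _ _) _; apply: le_trans (lerD (cN k) (dN k)) _.
rewrite -natrD ler_nat mulnDl leq_add // leq_mul2l leq_pexp2l ?weight_gt0 ?orbT //.
  exact: leq_addr.
exact: leq_addl.
Qed.

Lemma convergentZ (t : K) c : convergent c -> convergent (fun k => t * c k).
Proof.
have [T tT] := Cplx_bound (normr_ge0 t) => -[N [A cN]].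
exists (T * N)%N, A => k; rewrite normrM -mulnA natrM.
exact: ler_pM.
Qed.

Lemma convergent_conv c d : convergent c -> convergent d -> convergent (conv c d).
Proof.
move=> /convergentP[r [M [r0 cM]]] /convergentP[s [M' [s0 dM]]].
have [t [t0 tr ts]] := common_radius r0 s0.
have {}cM := bound_weaken t0 tr cM; have {}dM := bound_weaken t0 ts dM.
apply/convergentP; exists (t / 2 ^+ n), (M * M'); split.
  by rewrite divr_gt0 // exprn_gt0.
exact: conv_bound.
Qed.

End ConvergentOperations.

(** * The local ring of a germ is Noetherian and local *)

Section LocalRing.
Local Open Scope classical_set_scope.
Variables (R : realType) (n : nat) (X : germ R n).
Local Notation K := (Cplx R).
Local Notation x := (germ_pt X).
Local Notation O := (local_ring X).
Implicit Types (c d : {ffun 'I_n -> nat} -> K) (a b : O).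

(** A relation and not a function, because functions that agree on [X] near the point have the same
    class but possibly different power series. *)
Definition represents c a : Prop := convergent c /\ exists f : holo x,
  a = germ_class f /\ \forall y \near x, series_sum c (y - x) (val f y).

Lemma near_small (r : K) : 0 < r -> \forall y \near x, forall l, `|(y - x) 0 l| <= r.
Proof.
move=> r0; apply/nbhs_ballP; exists r => //= y xy l.
by rewrite !mxE distrC; apply/ltW; exact: xy.2.
Qed.

Lemma represents_exists a : exists c, represents c a.
Proof.
have [f ->] := germ_classW a.
have [c [r [M [r0 cM cf]]]] := asboolP _ (valP f).
by exists c; split; [apply/convergentP; exists r, M|exists f].
Qed.

Lemma represents_convergent c : convergent c -> exists a, represents c a.
Proof.
move=> cc; pose f y : K := xget 0 [set a | series_sum c (y - x) a].
have fE : \forall y \near x, series_sum c (y - x) (f y).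
  have [r r0 cr] := series_sum_exists cc.
  apply: filterS (near_small r0) => y /cr[a ca].
  by rewrite /f; case: xgetP => [_ -> //|/(_ a)].
have fx : analytic_at x f.
  by have [r [M [r0 cM]]] := (convergentP c).1 cc; exists c, r, M.
pose F : holo x := exist _ f (asboolT fx).
by exists (germ_class F); split=> //; exists F.
Qed.

Lemma represents_unique c a b : represents c a -> represents c b -> a = b.
Proof.
move=> [_ [f [-> cf]]] [_ [g [-> cg]]]; apply/germ_classP.
by move: cf cg; apply: filterS2 => y cf cg _; exact: series_sum_unique cf cg.
Qed.

Lemma represents_eval c a : represents c a -> germ_eval a = c [ffun=> 0%N].
Proof.
move=> [_ [f [-> /nbhs_singleton]]]; rewrite subrr germ_evalE => cf.
exact: series_sum_unique cf (@series_sum_at0 _ _ c).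
Qed.

Lemma representsD c d a b : represents c a -> represents d b ->
  represents (fun k => c k + d k) (a + b).
Proof.
move=> [cc [f [-> cf]]] [cd [g [-> dg]]]; split; first exact: convergentD.
exists (f + g); split; first by rewrite rmorphD.
by move: cf dg; apply: filterS2 => y cf dg; exact: series_sumD cf dg.
Qed.

(** Complex scalars act through [b], the class of a constant function. *)
Lemma representsZ t c a : represents c a ->
  exists b, represents (fun k => t * c k) (b * a).
Proof.
move=> [cc [f [-> cf]]]; pose T : holo x := exist _ (fun=> t) (asboolT (analytic_cst x t)).
exists (germ_class T); split; first exact: convergentZ.
exists (T * f); split; first by rewrite rmorphM.
by move: cf; apply: filterS => y cf; exact: series_sumZ cf.
Qed.

Lemma representsM c d a b : represents c a -> represents d b ->
  represents (conv c d) (a * b).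
Proof.
move=> [cc [f [-> cf]]] [cd [g [-> dg]]]; split; first exact: convergent_conv.
exists (f * g); split; first by rewrite rmorphM.
have [r r0 fg] := series_sum_conv cc cd.
move: cf dg (near_small r0); apply: filterS3 => y cf dg yr.
by rewrite -[val (f * g) y]/(val f y * val g y); exact: (fg _ yr _ _ cf dg).
Qed.

Lemma represents0 : represents (fun=> 0) 0.
Proof.
split; first by exists 0%N, 0%N => k; rewrite normr0 mul0n.
exists 0; split; first by rewrite rmorph0.
by near=> y; rewrite /series_sum; apply: cvg_near_cst; near=> N;
  rewrite /box_sum big1 // => k _; rewrite mul0r.
Unshelve. all: by end_near. Qed.

Lemma represents_sum s (c : 'I_s -> {ffun 'I_n -> nat} -> K) (a : 'I_s -> O) :
  (forall i, represents (c i) (a i)) ->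
  represents (fun k => \sum_i c i k) (\sum_i a i).
Proof.
move=> ca; elim: (index_enum _) => [|i r IH].
  rewrite big_nil (_ : (fun k => _) = (fun=> 0)); first exact: represents0.
  by apply/funext => k; rewrite big_nil.
rewrite big_cons (_ : (fun k => _) = (fun k => c i k + \sum_(j <- r) c j k)).
  exact: representsD.
by apply/funext => k; rewrite big_cons.
Qed.

Lemma series_eq0 (c : {ffun 'I_n -> nat} -> K) : ~ (forall k, c k = 0) ->
  exists k, c k != 0 /\ forall j, (weight j < weight k)%N -> c j = 0.
Proof.
move=> nc.
have ex : exists m, `[< exists2 k, c k != 0 & weight k = m >].
  apply: contrapT => no; apply: nc => k; apply: contrapT => /eqP ck.
  by apply: no; exists (weight k); apply/asboolP; exists k.
case: (ex_minnP ex) => _ /asboolP[k ck <-] min; exists k; split=> // j jk.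
apply: contrapT => /eqP cj; have : (weight k <= weight j)%N.
  by apply: min; apply/asboolP; exists j.
by rewrite leqNgt jk.
Qed.

(** Elements of [P] whose leading exponents generate all leading exponents of [P] generate [P]: the
    remainder of a division by them has no possible leading exponent. *)
Lemma local_ring_noetherian : noetherian_ring O.
Proof.
move=> P [P0 PD].
have PM a b : P b -> P (a * b) by move=> Pb; rewrite -[a * b]addr0; exact: PD.
have PDD a b : P a -> P b -> P (a + b).
  by move=> Pa Pb; have := PD 1 a b Pa Pb; rewrite scale1r.
(* All representatives count, those of 0 included, so [E] consists of the leading exponents of the
   preimage of [P] among convergent power series. *)
pose E e := exists c a, [/\ represents c a, P a, c e = 1 &
  forall k, (weight k < weight e)%N -> c k = 0].
have [s [e [eE eP]]] := dickson E.
have /choice[c /choice[a ca]] := eE.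
have [f fE] := linear_of_family (a : 'I_s -> O^o).
exists s, f => x; split=> [Px|[v <-]]; last first.
  apply: submodule_fam => // j; rewrite fE; by have [] := ca j.
have [g gx] := represents_exists x.
have [||||q qc qE] := @convergent_division R n s e c g.
- by move=> i; have [] := ca i.
- by move=> i; have [] := ca i.
- by move=> i; have [[]] := ca i.
- by case: gx.
have /choice[b qb] : forall i, exists b, represents (q i) b.
  by move=> i; exact: represents_convergent.
have sumE : represents (fun k => \sum_i conv (c i) (q i) k) (\sum_i a i * b i).
  by apply: represents_sum => i; apply: representsM => //; have [] := ca i.
have [t tE] := representsZ (-1) sumE; have {tE}rE := representsD gx tE.
have xE : x + t * (\sum_i a i * b i) = 0.
  apply: (represents_unique (c := fun=> 0)) represents0.
  rewrite [X in represents X](_ : _ = fun k => g k + -1 * \sum_i conv (c i) (q i) k) //.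
  apply/funext => k; apply/esym; move: k; apply: contrapT => /series_eq0[k [rk rlt]].
  (* Scaled to leading coefficient 1, a nonzero remainder would put its leading exponent [k] in [E],
     hence above some [e i], where the division is exact. *)
  have [u uE] := representsZ (g k + -1 * \sum_i conv (c i) (q i) k)^-1 rE.
  have /eP[i /(ex_intro (fun i => mle (e i) k)) /qE gk] : E k.
    do 2!eexists; split; [exact: uE| |by rewrite /= mulVf|by move=> j /rlt /= ->; rewrite mulr0].
    apply/PM/PDD => //; apply: (PM); elim/big_rec: _ => // i y _ Py.
    by apply: PDD => //; rewrite mulrC; apply: (PM); have [] := ca i.
  by case/eqP: rk; rewrite gk mulN1r subrr.
exists (\row_i (- t * b i)); rewrite [X in f X]row_sum_delta linear_sum.
move/eqP: xE; rewrite addr_eq0 => /eqP ->; rewrite -mulNr mulr_sumr.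
apply: eq_bigr => i _; rewrite linearZ fE mxE /=.
by rewrite -[_ *: _]/(_ * _) -mulrA [b i * _]mulrC.
Qed.

(** The unit series is divided by that of [a], scaled to constant term 1. The leading exponent 0
    divides every exponent, so there is no remainder. *)
Lemma local_ring_unit a : germ_eval a != 0 -> exists b, b * a = 1.
Proof.
pose z : {ffun 'I_n -> nat} := [ffun=> 0%N].
have [c ca] := represents_exists a; rewrite (represents_eval ca) -/z => c0.
have [t tca] := representsZ (c z)^-1 ca.
have z_le k : mle z k by apply/forallP => l; rewrite ffunE.
have [d d1] := represents_exists 1.
have [|i k|||q qc qE] := @convergent_division R n 1 (fun=> z) (fun _ k => (c z)^-1 * c k) d.
- by move=> _; rewrite mulVf.
- rewrite ltnNge dvdn_leq ?weight_gt0 // /weight big1 // => l _.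
  by rewrite ffunE expn0.
- by move=> _; case: tca.
- by case: d1.
have [b bq] := represents_convergent (qc ord0).
exists (b * t); rewrite -mulrA mulrC.
apply: represents_unique (representsM tca bq) _.
rewrite (_ : conv _ _ = d) //; apply/funext => k.
by rewrite qE ?big_ord1 //; exists ord0.
Qed.

End LocalRing.

(** * The formula for fibre products and for gluings *)

Section KernelIdeal.
Variables (A B : comNzRingType) (h : {rmorphism A -> B}).

Definition ker_pred : {pred A} := fun a => h a == 0.

Lemma ker_idealr_closed : idealr_closed ker_pred.
Proof.
split=> [||a u v]; rewrite !unfold_in ?rmorph0 ?rmorph1 ?oner_eq0 //.
by move=> /eqP hu /eqP hv; rewrite rmorphD rmorphM hu hv mulr0 addr0.
Qed.

(** Largeness quantifies over [idealr], so the kernel has to be packed as one; it is proper because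
    1 is not 0 in [B]. *)
Lemma ker_ideal_exists : exists I : idealr A, forall a, a \in I <-> h a = 0.
Proof.
exists (HB.pack_for (idealr A) ker_pred (isIdealr.Build A ker_pred ker_idealr_closed)) => a.
by split=> /eqP.
Qed.

End KernelIdeal.

Lemma quot_module_fg (A : comNzRingType) (I : idealr A) :
  finitely_generated (fun _ : quot_module I => True).
Proof.
have [q [q_onto _]] := quot_projection I.
have fL : linear (fun v : 'rV[A]_1 => q (v 0 0)).
  by move=> c u v; rewrite !mxE -[c * _]/(c *: (u 0 0 : A^o)) linearP.
exists 1%N, (mk_linear fL) => m; split=> // _; have [a <-] := q_onto m.
by exists a%:M; rewrite /= mxE eqxx.
Qed.

Theorem fiber_product_formula (k : fieldType) (A B D : comNzRingType)
    (f : {rmorphism A -> D}) (g : {rmorphism B -> D})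
    (resA : {rmorphism A -> k}) (resB : {rmorphism B -> k})
    (V := fiber_product f g) (p1 := @fiber_fst _ _ _ f g : {rmorphism V -> A})
    (p2 := @fiber_snd _ _ _ f g : {rmorphism V -> B})
    (resV := resA \o p1 : {rmorphism V -> k}) (I : idealr B) :
  onto f -> onto g ->
  (forall a b, f a = g b -> resA a = resB b) ->
  (forall (d : D) n, d ^+ n = 0 -> d = 0) ->
  noetherian_ring A -> noetherian_ring B ->
  (forall a, resA a != 0 -> exists b, b * a = 1) ->
  (forall b, resB b != 0 -> exists c, c * b = 1) ->
  (poincare resV (restrict_scalars p1 (ker_module f)) =
     poincare resA (ker_module f) * poincare_hom resV p1 /\
   exists phi : {rmorphism B -> A}, forall t, f (phi t) = g t) \/
  (large resV resA p1 /\ large resV resB p2) ->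
  radical I ->
  poincare resV (restrict_scalars p2 (quot_module I)) =
    poincare resB (quot_module I) * poincare_hom resA f /
      (poincare_hom resA f + poincare_hom resB g - poincare_hom resA f * poincare_hom resB g).
Proof.
move=> f_onto g_onto res_fg D_red A_noeth B_noeth A_local B_local hyp I_rad.
have u := gluing_denominator_unit f_onto g_onto res_fg A_noeth B_noeth A_local B_local.
suff [e1 e2] : poincare resV (restrict_scalars p2 (quot_module I)) =
      poincare resB (quot_module I) * poincare_hom resV p2 /\
    poincare_hom resV p2 * (poincare_hom resA f + poincare_hom resB g -
      poincare_hom resA f * poincare_hom resB g) = poincare_hom resA f.
  by rewrite -{1}e2 mulrA mulrK.
case: hyp => [[eK [phi phiE]]|[[_ large1] [_ large2]]]; split.
- exact: (poincare_fiber_retract f_onto g_onto res_fg A_noeth B_noeth A_local B_local phiE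
    (quot_module_fg I)).
- exact: (weakly_large_series f_onto g_onto res_fg A_noeth B_noeth A_local B_local phiE eK).
- exact: large2.
(* Since [D] is reduced the two kernels are radical, so largeness applies to [D] as a subspace on
   either side. *)
have [J JE] := ker_ideal_exists f; have [L LE] := ker_ideal_exists g.
apply: (strongly_large_series f_onto g_onto res_fg A_noeth B_noeth A_local B_local JE LE).
  by apply: large1 => a n /JE; rewrite rmorphXn => /D_red /JE.
by apply: large2 => b n /LE; rewrite rmorphXn => /D_red /LE.
Qed.

Section Germs.
Variable R : realType.

Lemma germ_reduced n (Z : germ R n) (a : local_ring Z) m : a ^+ m = 0 -> a = 0.
Proof.
have [f ->] := germ_classW a; rewrite -rmorphXn -(rmorph0 (@germ_class _ _ Z)).
move=> /germ_classP fm0; apply/germ_classP; apply: filterS fm0 => u fm0 Zu.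
have {fm0} : val (f ^+ m) u = 0 by exact: fm0.
have -> : val (f ^+ m) u = val f u ^+ m.
  elim: m => [|m IH] //; rewrite !exprS -IH //.
by move=> /eqP; rewrite expf_eq0 => /andP[_ /eqP].
Qed.

(** Morphisms of germs preserve base points. Hence the two residue maps agree on pairs with a common
    image in the local ring of [Z]. *)
Lemma pullback_eval n m (Z : germ R n) (X : germ R m) (F : germ_morphism Z X) a :
  germ_eval (pullback F a) = germ_eval a.
Proof.
have [b [f [g [-> _ fg]]]] := pullback_ex F a.
rewrite (pullbackE fg) !germ_evalE.
by rewrite (nbhs_singleton fg (germ_ptP Z)) gm_pt.
Qed.

End Germs.

Theorem theorem3p13 (R : realType) (n m l : nat)
  (X : germ R n) (Y : germ R m) (Z : germ R l)
  (alpha : germ_morphism Z X) (beta : germ_morphism Z Y)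
  (alpha_onto : onto (pullback alpha)) (beta_onto : onto (pullback beta))
  (alpha_niso : ~ bijective (pullback alpha))
  (beta_niso : ~ bijective (pullback beta))
  (hyp : (weakly_large_gluing alpha beta /\
          exists phi : {rmorphism local_ring Y -> local_ring X},
            onto phi /\ forall t, pullback alpha (phi t) = pullback beta t)
         \/ strongly_large_gluing alpha beta)
  (I : idealr (local_ring Y)) (I_radical : radical I) :
  let P_V_W := poincare (gluing_eval alpha beta)
                 (restrict_scalars (gluing_snd alpha beta) (quot_module I)) in
  let P_Y_W := poincare (@germ_eval R m Y) (quot_module I) in
  let P_X_Z := poincare_hom (@germ_eval R n X) (pullback alpha) in
  let P_Y_Z := poincare_hom (@germ_eval R m Y) (pullback beta) in
  P_V_W = P_Y_W * P_X_Z / (P_X_Z + P_Y_Z - P_X_Z * P_Y_Z).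
Proof.
apply: (@fiber_product_formula (Cplx R) _ _ _ (pullback alpha) (pullback beta)
  (@germ_eval R n X) (@germ_eval R m Y) I alpha_onto beta_onto) => //.
- move=> a b ab; apply: etrans (esym (pullback_eval alpha a)) _.
  by apply: etrans (pullback_eval beta b); exact: congr1 ab.
- exact: germ_reduced.
- exact: local_ring_noetherian.
- exact: local_ring_noetherian.
- exact: local_ring_unit.
- exact: local_ring_unit.
case: hyp => [[weak [phi [_ phiE]]]|strong]; [left|right].
  by split; [exact: weak|exists phi].
exact: strong.
Qed.
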